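(* Let $n\ge2$. The Radon measure $d\mu=w\,dx=|x'|^{\theta_1}|x|^{\theta_2}|x_n|^{\theta_3}dx$ on $\mathbb{R}^n$ is doubling when $(\theta_1,\theta_2,\theta_3)\in\mathcal{A}\cup\mathcal{B}$.
   Context: Write $x=(x',x_n)\in\mathbb{R}^n$ with $x'=(x_1,\dots,x_{n-1})$. Define $$\mathcal{A}=\{(\theta_1,\theta_2,\theta_3):\theta_1>-(n-1),\ \theta_2\ge 0,\ \theta_3>-1\},$$ $$\mathcal{B}=\{(\theta_1,\theta_2,\theta_3):\theta_1>-(n-1),\ \theta_2<0,\ \theta_3>-1,\ \theta_1+\theta_2+\theta_3>-n\}.$$ A Radon measure $\mu$ on $\mathbb{R}^n$ is called doubling if there is a constant $0<C<\infty$ such that $\mu(B_{2R}(\bar x))\le C\mu(B_R(\bar x))$ for any $\bar x\in\mathbb{R}^n$ and $R>0$, where $B_R(\bar x)$ is the ball of radius $R$ centred at $\bar x$. *)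

(* Defs.v *)
From HB Require Import structures.
From mathcomp Require Import all_boot all_order all_algebra.
From mathcomp Require Import all_classical all_reals all_analysis measurable_realfun.

Set Implicit Arguments.
Unset Strict Implicit.
Unset Printing Implicit Defensive.

Import Order.TTheory GRing.Theory Num.Theory.
Import numFieldNormedType.Exports.

Local Open Scope classical_set_scope.
Local Open Scope ring_scope.

(* R^n is ['rV[R]_n], with the Borel sigma-algebra of the library's topology
   (that of the sup norm, hence the usual one). *)
Section borel_row.
Context {R : realType} (n : nat).

Let O : set (set 'rV[R]_n) := open.

HB.instance Definition _ := @isMeasurable.Build
  (sigma_display (@open 'rV[R]_n)) 'rV[R]_n <<s @open 'rV[R]_n >>
  (@sigma_algebra0 _ setT O) (@sigma_algebraC _ O)
  (@sigma_algebra_bigcup _ setT O).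

Lemma open_measurable_rV (U : set 'rV[R]_n) : open U -> measurable U.
Proof. exact: sub_sigma_algebra. Qed.

Lemma measurable_coord (i : 'I_n) :
  measurable_fun setT (fun x : 'rV[R]_n => x ord0 i).
Proof.
apply: (measurability _ (RGenOpens.measurableE R)).
move=> _ [_ [a [b ->] <-]]; rewrite setTI; apply: open_measurable_rV.
by apply: open_comp (interval_open _ _) => // x _; exact: coord_continuous.
Qed.

Lemma measurable_fun_rV d (T : measurableType d) (f : T -> 'rV[R]_n) :
  (forall i, measurable_fun setT (fun t => f t ord0 i)) ->
  measurable_fun setT f.
Proof.
move=> mf; apply: (@measurability _ _ T 'rV[R]_n setT f O erefl) => _ [U oU <-]; rewrite setTI.
pose c (p : 'rV[rat]_n * nat) : set 'rV[R]_n :=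
  ball (map_mx (@ratr R) p.1 : 'rV[R]_n) p.2.+1%:R^-1.
have mc p : measurable (f @^-1` c p).
  rewrite (_ : _ @^-1` _ = \bigcap_(i in [set: 'I_n])
      ((fun t => f t ord0 i) @^-1` ball (ratr (p.1 ord0 i) : R) p.2.+1%:R^-1)).
    apply: fin_bigcap_measurable => [|i _]; first exact: finite_finset.
    rewrite -[X in measurable X]setTI; apply: mf => //.
    by apply: open_measurable; exact: ball_open.
  apply/seteqP; split=> [t [_ ct] i _|t ct]; first by have := ct ord0 i; rewrite mxE.
  by split=> [|i j]; [rewrite invr_gt0|rewrite ord1 mxE; exact: ct].
suff -> : f @^-1` U =
    \bigcup_p (if pselect (c p `<=` U) then f @^-1` c p else set0).
  apply: countable_bigcupT_measurable => [|p]; first exact: countableP.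
  by case: (pselect (c p `<=` U)) => _ /=; [exact: mc|exact: measurable0].
apply/seteqP; split => [t Ut|t [p _]]; last first.
  by case: (pselect (c p `<=` U)) => // pU; exact: pU.
have [e /= e0 eU] := (nbhs_ballP _ _).1 (open_nbhs_nbhs (conj oU Ut)).
have [k ke] : exists k : nat, k.+1%:R^-1 < e / 2.
  have e20 : 0 < e / 2 by rewrite divr_gt0.
  by exists (Num.truncn (e / 2)^-1); rewrite invf_plt ?posrE// truncnS_gt.
have k0 : 0 < k.+1%:R^-1 :> R by rewrite invr_gt0.
have qP i : exists q : rat, ball (f t ord0 i) k.+1%:R^-1 (ratr q : R).
  have [|r [fr [q _ qr]]] := @dense_rat R (ball (f t ord0 i) k.+1%:R^-1) _
    (ball_open _ _).
    by exists (f t ord0 i); exact: ballxx.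
  by exists q; rewrite qr.
have [q {}qP] := choice qP.
have ctq : c (\row_i q i, k) (f t).
  by split=> [|i j]; [rewrite invr_gt0|rewrite ord1 !mxE; exact/ball_sym/qP].
exists (\row_i q i, k) => //; case: (pselect (c _ `<=` U)) => //= -[].
move=> y [_ cy]; apply: eU; split=> // i j; rewrite ord1.
have := cy ord0 j; rewrite !mxE => yj.
apply: (@le_ball _ _ _ (k.+1%:R^-1 + k.+1%:R^-1)).
  by rewrite (splitr e) lerD// ltW.
exact: (ball_triangle (qP j) yj).
Qed.

End borel_row.

(* [snoc (x', t)] is the point [x = (x', t)] of R^(n+1); [proj_init] and
   [proj_last] are the two components of x. *)
Section last_coordinate.
Context {R : realType} (n : nat).

Definition proj_init (x : 'rV[R]_n.+1) : 'rV[R]_n := col' ord_max x.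

Definition proj_last (x : 'rV[R]_n.+1) : R := x ord0 ord_max.

Definition snoc (p : 'rV[R]_n * R) : 'rV[R]_n.+1 :=
  \row_i oapp (p.1 ord0) p.2 (unlift ord_max i).

Lemma snocK : cancel snoc (fun x => (proj_init x, proj_last x)).
Proof.
move=> [v t]; congr pair; last by rewrite /proj_last mxE unlift_none.
by apply/rowP => i; rewrite !mxE liftK.
Qed.

Lemma proj_snocK : cancel (fun x => (proj_init x, proj_last x)) snoc.
Proof.
move=> x; apply/rowP => i; rewrite mxE.
by case: unliftP => [j ->|->] //=; rewrite mxE.
Qed.

Lemma measurable_proj_init : measurable_fun setT proj_init.
Proof.
apply: measurable_fun_rV => i; under eq_fun do rewrite mxE.
exact: measurable_coord.
Qed.

Lemma measurable_proj_last : measurable_fun setT proj_last.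
Proof. exact: measurable_coord. Qed.

Lemma measurable_snoc : measurable_fun setT snoc.
Proof.
apply: measurable_fun_rV => i; under eq_fun do rewrite mxE.
case: unliftP => [j _|_] /=; last exact: measurable_snd.
by apply: (measurableT_comp (measurable_coord j)); exact: measurable_fst.
Qed.

End last_coordinate.

(* Lebesgue measure on R^n, as the n-fold product of the one-dimensional one. *)
Section lebesgue_row.
Context {R : realType}.

Section step.
Variables (n : nat) (m : {sigma_finite_measure set 'rV[R]_n -> \bar R}).

Definition lebesgue_snoc : set 'rV[R]_n.+1 -> \bar R :=
  pushforward (m \x (@lebesgue_measure R))%E (@snoc R n).

Let lebesgue_snoc0 : lebesgue_snoc set0 = 0%E.
Proof. by rewrite /lebesgue_snoc /pushforward preimage_set0 measure0. Qed.

Let lebesgue_snoc_ge0 A : (0 <= lebesgue_snoc A)%E.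
Proof. by rewrite /lebesgue_snoc /pushforward; exact: measure_ge0. Qed.

Let lebesgue_snoc_sigma_additive : semi_sigma_additive lebesgue_snoc.
Proof.
move=> F mF tF mUF; rewrite /lebesgue_snoc /pushforward preimage_bigcup.
have ms A : measurable A -> measurable (@snoc R n @^-1` A).
  by move=> mA; rewrite -[X in measurable X]setTI; exact: measurable_snoc.
apply: measure_semi_sigma_additive; [by move=> i; exact: ms| |].
- apply/trivIsetP => /= i j _ _ ij; rewrite -preimage_setI.
  by move/trivIsetP : tF => /(_ _ _ _ _ ij) ->//; rewrite preimage_set0.
- by rewrite -preimage_bigcup; exact: ms.
Qed.

HB.instance Definition _ := isMeasure.Build _ _ _ lebesgue_snoc
  lebesgue_snoc0 lebesgue_snoc_ge0 lebesgue_snoc_sigma_additive.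

Let lebesgue_snoc_sigma_finite : sigma_finite setT lebesgue_snoc.
Proof.
have /sigma_finiteP[F [FT ndF Foo]] := sigma_finiteT m.
have /sigma_finiteP[G [GT ndG Goo]] := sigma_finiteT (@lebesgue_measure R).
exists (fun k => @proj_init R n @^-1` F k `&` @proj_last R n @^-1` G k).
  apply/esym; rewrite -subTset => x _.
  have [i _ Fi] : (\bigcup_i F i) (proj_init x) by rewrite -FT.
  have [j _ Gj] : (\bigcup_j G j) (proj_last x) by rewrite -GT.
  exists (maxn i j) => //; split.
    by have /subsetPset := ndF _ _ (leq_maxl i j); apply.
  by have /subsetPset := ndG _ _ (leq_maxr i j); apply.
move=> k; have [mF Fk] := Foo k; have [mG Gk] := Goo k; split.
  apply: measurableI; rewrite -[X in measurable X]setTI.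
    exact: measurable_proj_init.
  exact: measurable_proj_last.
rewrite /lebesgue_snoc /pushforward (_ : _ @^-1` _ = F k `*` G k).
  by rewrite product_measure1E// lte_mul_pinfty// ge0_fin_numE.
have snoc_init p : proj_init (@snoc R n p) = p.1 by rewrite -[in RHS](snocK p).
have snoc_last p : proj_last (@snoc R n p) = p.2 by rewrite -[in RHS](snocK p).
by apply/seteqP; split=> p /=; rewrite snoc_init snoc_last.
Qed.

HB.instance Definition _ := Measure_isSigmaFinite.Build _ _ _ lebesgue_snoc
  lebesgue_snoc_sigma_finite.

End step.

Fixpoint lebesgue_rV (n : nat) : {sigma_finite_measure set 'rV[R]_n -> \bar R} :=
  match n with
  | 0 => dirac (0 : 'rV[R]_0)
  | n'.+1 => lebesgue_snoc (lebesgue_rV n')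
  end.

Lemma lebesgue_rV_box (n : nat) (a b : 'rV[R]_n) :
  (forall i, a ord0 i <= b ord0 i) ->
  lebesgue_rV n [set x | forall i, x ord0 i \in `]a ord0 i, b ord0 i]] =
  (\prod_i (b ord0 i - a ord0 i))%:E.
Proof.
elim: n a b => [|n IHn] a b ab.
  by rewrite big_ord0 /= diracE mem_set// => -[].
pose A : set 'rV[R]_n := [set x | forall i, x ord0 i \in
  `](proj_init a) ord0 i, (proj_init b) ord0 i]].
have mA : measurable A.
  rewrite (_ : A = \bigcap_(i in [set: 'I_n]) ((fun x : 'rV[R]_n => x ord0 i)
      @^-1` [set` `](proj_init a) ord0 i, (proj_init b) ord0 i]])).
    apply: fin_bigcap_measurable => [|i _]; first exact: finite_finset.
    by rewrite -[X in measurable X]setTI; apply: measurable_coord.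
  by apply/seteqP; split=> [x xA i _|x xA i]; [exact: xA|exact: (xA i)].
rewrite /= /lebesgue_snoc /pushforward.
rewrite (_ : _ @^-1` _ =
    A `*` [set` `]proj_last a, proj_last b]]); last first.
  apply/seteqP; split => [[v t] /= vt|[v t] /= [vA tB] i].
    split=> [i|]; last by have := vt ord_max; rewrite mxE unlift_none.
    by have := vt (lift ord_max i); rewrite !mxE liftK.
  by rewrite mxE; case: unliftP => [j ->|->] //=; have := vA j; rewrite !mxE.
transitivity (lebesgue_rV n A *
    lebesgue_measure [set` `]proj_last a, proj_last b]])%E.
  exact: product_measure1E.
have -> : lebesgue_rV n A =
    (\prod_i (proj_init b ord0 i - proj_init a ord0 i))%:E.
  by apply: IHn => i; rewrite !mxE.
have -> : lebesgue_measure [set` `]proj_last a, proj_last b]] =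
    (proj_last b - proj_last a)%:E.
  rewrite lebesgue_measure_itv/= lte_fin; case: ltP => [_|ba]; first exact: EFinB.
  by have /eqP -> : proj_last a == proj_last b; [rewrite eq_le ab|rewrite subrr].
rewrite -EFinM big_ord_recr /=; congr (_ * _)%:E.
apply: eq_bigr => i _; rewrite !mxE.
by rewrite (_ : lift _ _ = widen_ord (leqnSn n) i)//; apply/val_inj => /=; rewrite /bump leqNgt ltn_ord.
Qed.

End lebesgue_row.

Definition enorm {R : realType} {n : nat} (x : 'rV[R]_n) : R :=
  Num.sqrt (\sum_i x ord0 i ^+ 2).

Definition eball {R : realType} {n : nat} (x : 'rV[R]_n) (r : R) :
    set 'rV[R]_n :=
  [set y | enorm (y - x) < r].

Definition radon {R : realType} {n : nat}
    (mu : {measure set 'rV[R]_n -> \bar R}) : Prop :=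
  [/\ forall K, compact K -> (mu K < +oo)%E,
      forall A, measurable A ->
        mu A = ereal_inf [set mu U | U in [set U | open U /\ A `<=` U]] &
      forall U, open U ->
        mu U = ereal_sup [set mu K | K in [set K | compact K /\ K `<=` U]]].

Definition doubling {R : realType} {n : nat}
    (mu : {measure set 'rV[R]_n -> \bar R}) : Prop :=
  exists C : R, 0 < C /\ forall (x : 'rV[R]_n) (r : R), 0 < r ->
    (mu (eball x (2 * r)) <= C%:E * mu (eball x r))%E.

(* In both sets n is the dimension of the ambient space R^n. *)
Definition paramA {R : realType} (n : nat) : set (R * R * R) :=
  [set theta | let: (t1, t2, t3) := theta in
    [/\ - (n%:R - 1) < t1, 0 <= t2 & -1 < t3]].

Definition paramB {R : realType} (n : nat) : set (R * R * R) :=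
  [set theta | let: (t1, t2, t3) := theta in
    [/\ - (n%:R - 1) < t1, t2 < 0, -1 < t3 & - n%:R < t1 + t2 + t3]].

Section weight.
Context {R : realType} (n : nat).
Implicit Types theta : R * R * R.

(* [powR] is real-valued: [0 `^ t = 0] for every t != 0, negative ones included.
   For t < 0 this only alters the weight on the null set where one of the
   three factors vanishes. *)
Definition weight theta (x : 'rV[R]_n.+1) : R :=
  let: (t1, t2, t3) := theta in
  enorm (proj_init x) `^ t1 * enorm x `^ t2 * `|proj_last x| `^ t3.

Lemma measurable_enorm m : measurable_fun setT (@enorm R m).
Proof.
have msqrt : measurable_fun setT (@Num.sqrt R).
  by apply: continuous_measurable_fun; exact: sqrt_continuous.
apply: (measurableT_comp msqrt).
by apply: measurable_sum => i; apply: measurable_funX; exact: measurable_coord.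
Qed.

Lemma measurable_weight theta : measurable_fun setT (weight theta).
Proof.
case: theta => [[t1 t2] t3]; apply: measurable_funM; first apply: measurable_funM.
- apply: (measurableT_comp (measurable_powR t1)).
  by apply: (measurableT_comp (measurable_enorm (m := n)));
    exact: measurable_proj_init.
- by apply: (measurableT_comp (measurable_powR t2)); exact: measurable_enorm.
- apply: (measurableT_comp (measurable_powR t3)).
  by apply: measurableT_comp => //; exact: measurable_proj_last.
Qed.

Lemma weight_ge0 theta x : 0 <= weight theta x.
Proof. by case: theta => [[t1 t2] t3]; rewrite /= !mulr_ge0// powR_ge0. Qed.

Definition weighted_measure theta (A : set 'rV[R]_n.+1) : \bar R :=
  (\int[@lebesgue_rV R n.+1]_(x in A) (weight theta x)%:E)%E.

Variable theta : R * R * R.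

Let weighted_measure0 : weighted_measure theta set0 = 0%E.
Proof. exact: integral_set0. Qed.

Let weighted_measure_ge0 A : (0 <= weighted_measure theta A)%E.
Proof. by apply: integral_ge0 => x _; rewrite lee_fin weight_ge0. Qed.

Let weighted_measure_sigma_additive :
  semi_sigma_additive (weighted_measure theta).
Proof.
apply: semi_sigma_additive_nng_induced => [|x].
  by apply/measurable_EFinP; exact: measurable_weight.
by rewrite lee_fin weight_ge0.
Qed.

HB.instance Definition _ := isMeasure.Build _ _ _ (weighted_measure theta)
  weighted_measure0 weighted_measure_ge0 weighted_measure_sigma_additive.

End weight.

Arguments weighted_measure {R} n theta A.

(* Main.v *)
(* Let M(x, r) = (|x'| + r)^a (|x| + r)^b (|x_n| + r)^c r^n, with sup norms. The
   weighted measure of the cube of centre x and half-side r is comparable to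
   M(x, r), and M(x, k r) <= C_k M(x, r) is clear, so the measure is doubling.
   Lower bound: pushing each coordinate of x away from 0 by r / 2 gives a subcube
   on which |y'|, |y| and |y_n| are comparable to |x'| + r, |x| + r, |x_n| + r.
   Upper bound: when |x| >= 2 r or b >= 0, |y|^b <= C (|x| + r)^b factors out and
   a product integral remains; when |x| < 2 r and b < 0, split b = b1 + b2 with
   b1, b2 <= 0, a + b1 > -(n - 1), c + b2 > -1 (possible exactly because
   a + b + c > -n) and use |y|^b <= |y'|^b1 |y_n|^b2. The same splitting, with
   a = c = 0, proves the bound for the power |y'|^a itself by induction on the
   dimension.
   Regularity holds for every locally finite Borel measure on R^n, because open
   sets are sigma-compact. *)
Require Import Defs.
From mathcomp Require Import all_boot all_order all_algebra.
From mathcomp Require Import all_classical all_reals all_analysis.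
From mathcomp Require Import measurable_realfun ring lra.

Set Implicit Arguments.
Unset Strict Implicit.
Unset Printing Implicit Defensive.

Import Order.TTheory GRing.Theory Num.Theory.
Import numFieldNormedType.Exports.

Local Open Scope classical_set_scope.
Local Open Scope ring_scope.

(** * Powers of comparable numbers and one-dimensional power integrals *)

(** Monotonicity of the power settles nonnegative exponents; for negative ones it is applied to the
    inverses, which exchanges the roles of the two hypotheses. *)
Lemma powR_comparable (R : realType) (K u v th : R) :
  1 <= K -> 0 <= u -> 0 <= v -> u <= K * v -> v <= K * u ->
  u `^ th <= K `^ `|th| * v `^ th.
Proof.
move=> K1 u0 v0 uv vu; have K0 : 0 <= K by rewrite (le_trans ler01).
have [th0|th0] := leP 0 th.
  by rewrite ger0_norm// -powRM// ge0_ler_powR// nnegrE mulr_ge0.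
rewrite ltr0_norm//.
(* With the convention that zero to a negative power is 0, the left side vanishes here. This also
   disposes of [v = 0], which forces [u = 0]. *)
have [u0'|un0] := eqVneq u 0.
  rewrite u0' powR0 ?lt_eqF// mulr_ge0 ?powR_ge0//.
have {un0}u0' : 0 < u by rewrite lt_def un0.
have v0' : 0 < v by rewrite -(pmulr_rgt0 v (lt_le_trans ltr01 K1)) (lt_le_trans u0').
have nth : 0 <= - th by rewrite oppr_ge0 ltW.
rewrite -[in X in X <= _](opprK th) -[in X in _ <= _ * X](opprK th) 2!(powRN _ (- th)).
rewrite ler_pdivlMr ?powR_gt0// mulrC ler_pdivrMr ?powR_gt0// -powRM//.
by rewrite ge0_ler_powR// nnegrE mulr_ge0.
Qed.

(** The singularity at 0 is avoided by exhausting the interval with [[r / k.+1, r]]. There the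
    primitive [s^(g+1) / (g+1)] is available, and its value at the left end is dropped as
    nonnegative. *)
Lemma lebesgue_powR_le (R : realType) (g r : R) : - 1 < g -> 0 < r ->
  (\int[lebesgue_measure]_(s in [set` `]0%R, r]]) (s `^ g)%:E <=
   ((g + 1)^-1 * (r `^ g * r))%:E)%E.
Proof.
move=> g1 r0; have g10 : 0 < g + 1 by lra.
pose F (k : nat) : set R := `[r / k.+1%:R, r]%classic.
have FE : [set` `]0, r]] = \bigcup_k F k.
  apply/seteqP; split => [s|s [k _]]; rewrite /F /= !in_itv/= => /andP[s0 sr].
    exists (Num.truncn (r / s)) => //=; rewrite in_itv/= sr andbT.
    by rewrite ler_pdivrMr// mulrC -ler_pdivrMr// ltW// truncnS_gt.
  by rewrite sr andbT (lt_le_trans _ s0)// divr_gt0.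
have mp A : measurable A -> measurable_fun A (fun s : R => (s `^ g)%:E).
  move=> mA; apply/measurable_EFinP; apply: measurable_funTS.
  exact: measurable_powR.
have cvgF : (\int[lebesgue_measure]_(s in F k) (s `^ g)%:E @[k --> \oo] -->
   \int[lebesgue_measure]_(s in [set` `]0%R, r]]) (s `^ g)%:E)%E.
  rewrite FE; apply: ge0_nondecreasing_set_cvg_integral.
  - move=> i j ij; apply/subsetPset => s; rewrite /F /= !in_itv/= => /andP[s0 ->].
    rewrite andbT (le_trans _ s0)// ler_pM2l// lef_pV2 ?posrE//.
    by rewrite ler_nat.
  - by move=> i; exact: measurable_itv.
  - by move=> i; apply: mp; exact: measurable_itv.
  - by move=> i x _; rewrite lee_fin powR_ge0.
pose P (s : R) := (g + 1)^-1 *: (s `^ (g + 1)).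
have dP : {in `]0, +oo[%R, forall s, derivable P s 1}.
  by move=> s s0; apply: derivableZ; exact: derivable_powR.
have cP : {in `]0, +oo[%R, continuous P}.
  by move=> s s0; apply/differentiable_continuous/derivable1_diffP; exact: dP.
(* The index 0 gives the degenerate interval [[r, r]], while the fundamental theorem is applied with
   distinct endpoints. *)
apply: (cvge_to_le cvgF); exists 1%N => // k /= k0.
have rk0 : 0 < r / k.+1%:R by rewrite divr_gt0.
have rkr : r / k.+1%:R < r.
  by rewrite ltr_pdivrMr// ltr_pMr// ltr1n ltnS.
have gt0 (s : R) : r / k.+1%:R <= s -> s \in `]0, +oo[.
  by move=> /(lt_le_trans rk0) s0; rewrite in_itv/= s0.
rewrite (@continuous_FTC2 _ (fun s => s `^ g) P)//.
- rewrite -EFinB lee_fin (_ : r `^ g * r = r `^ (g + 1)); last first.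
    by rewrite powRD ?gt_eqF ?implybT// powRr1// ltW.
  by rewrite gerBl// mulr_ge0 ?powR_ge0// invr_ge0 ltW.
- apply: continuous_in_subspaceT => s; rewrite inE /= in_itv/= => /andP[s0 _].
  apply/differentiable_continuous/derivable1_diffP.
  exact/derivable_powR/gt0.
- split.
  + move=> s; rewrite in_itv/= => /andP[/ltW s0 _].
    exact/dP/gt0.
  + by apply: cvg_at_right_filter; exact/cP/gt0.
  + by apply: cvg_at_left_filter; apply/cP/gt0/ltW.
- move=> s; rewrite in_itv/= => /andP[/ltW/gt0 s0 _].
  rewrite /P derive1E deriveZ; last exact: derivable_powR.
  by rewrite -derive1E powR_derive1// addrK scalerA mulVf ?gt_eqF// scale1r.
Qed.

Lemma lebesgue_norm_powR_le (R : realType) (g r : R) : - 1 < g -> 0 < r ->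
  (\int[lebesgue_measure]_(s in ball (0%R : R) r) (`|s| `^ g)%:E <=
   (2 * (g + 1)^-1 * (r `^ g * r))%:E)%E.
Proof.
move=> g1 r0.
have mp : measurable_fun setT (fun s : R => (`|s| `^ g)%:E).
  apply/measurable_EFinP.
  by apply: (measurableT_comp (measurable_powR g)); exact: normr_measurable.
have pos : (\int[lebesgue_measure]_(s in [set` `]0%R, r]]) (`|s| `^ g)%:E <=
   ((g + 1)^-1 * (r `^ g * r))%:E)%E.
  apply: le_trans (lebesgue_powR_le g1 r0); rewrite le_eqVlt; apply/orP; left.
  apply/eqP; apply: eq_integral.
  by move=> s; rewrite inE/= in_itv/= => /andP[s0 _]; rewrite gtr0_norm.
have neg : (\int[lebesgue_measure]_(s in [set` `[(- r)%R, 0%R]]) (`|s| `^ g)%:E =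
    \int[lebesgue_measure]_(s in [set` `]0%R, r]]) (`|s| `^ g)%:E)%E.
  (* Adding the null point 0 makes the interval the exact reflection of [[- r, 0]]. *)
  rewrite integral_itv_obnd_cbnd; last exact: measurable_funTS.
  rewrite (_ : [set` `[(- r)%R, 0%R]] =
      (-%R : _ -> measurableTypeR R) @^-1` [set` `[0%R, r]]); last first.
    by rewrite opp_preimage_itvbndbnd/= oppr0.
  transitivity (\int[lebesgue_measure]_(s in
      (-%R : _ -> measurableTypeR R) @^-1` [set` `[0%R, r]])
      (((fun s => (`|s| `^ g)%:E) \o (-%R : _ -> measurableTypeR R)) s))%E.
    by apply: eq_integral => s _; rewrite /= normrN.
  rewrite -ge0_integral_pushforward//=; last exact: measurable_funTS.
  by apply: eq_measure_integral => //= A mA AS; exact: lebesgue_measureN.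
apply: (@le_trans _ _ (\int[lebesgue_measure]_(s in
    [set` `[(- r)%R, 0%R]] `|` [set` `]0%R, r]]) (`|s| `^ g)%:E)%E).
  apply: ge0_subset_integral => //.
  - exact: measurable_ball.
  - exact: measurableU.
  - exact: measurable_funTS.
  - move=> s /=; rewrite /ball/= sub0r normrN ltr_norml !in_itv/= => /andP[rs sr].
    by have [s0|s0] := leP s 0; [left|right]; rewrite ltW.
rewrite ge0_integral_setU//=.
- rewrite neg (_ : 2 * _ * _ =
    (g + 1)^-1 * (r `^ g * r) + (g + 1)^-1 * (r `^ g * r)); last by ring.
  by rewrite EFinD leeD.
- exact: measurable_funTS.
- rewrite disj_set2E; apply/eqP; rewrite -subset0 => s [] /=.
  by rewrite !in_itv/= => /andP[_ +] /andP[+ _]; lra.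
Qed.

(* The singularity at 0 only matters when g < 0 and |t| < 2 r; if |t| >= 2 r then
   |s| is comparable to |t| + r on the whole interval. *)
Lemma lebesgue_powR_ball_le (R : realType) (g : R) : - 1 < g ->
  exists2 C : R, 0 < C & forall t r : R, 0 < r ->
  (\int[lebesgue_measure]_(s in ball t r) (`|s| `^ g)%:E <=
   (C * ((`|t| + r) `^ g * r))%:E)%E.
Proof.
move=> g1.
have g10 : 0 < g + 1 by lra.
(* The ratio 3 serves both regimes: [2 r <= |t|] gives [|t| + r <= 3 |s|] on the interval, and
   [|t| < 2 r] gives [|t| + r <= 3 r]. *)
pose K : R := 3%:R `^ `|g|.
have K0 : 0 < K by rewrite powR_gt0.
have mp (A : set R) : measurable A -> measurable_fun A (fun s : R => (`|s| `^ g)%:E).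
  move=> mA; apply/measurable_EFinP; apply: measurable_funTS.
  by apply: (measurableT_comp (measurable_powR g)); exact: normr_measurable.
have far (t r : R) : 0 < r ->
    (forall s, ball t r s -> `|s| `^ g <= K * (`|t| + r) `^ g) ->
  (\int[lebesgue_measure]_(s in ball t r) (`|s| `^ g)%:E <=
   ((2 * K) * ((`|t| + r) `^ g * r))%:E)%E.
  move=> r0 sr.
  apply: (@le_trans _ _ (\int[lebesgue_measure]_(s in ball t r)
      (K * (`|t| + r) `^ g)%:E)%E).
    apply: ge0_le_integral => //; first exact: measurable_ball.
    by apply: mp; exact: measurable_ball.
  rewrite [leLHS]integral_cst; last exact: measurable_ball.
  rewrite [X in (_ * X)%E](_ : _ = (r *+ 2)%:E); last first.
    exact: lebesgue_measure_ball (ltW r0).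
  rewrite -EFinM lee_fin -mulr_natr.
  by rewrite le_eqVlt; apply/orP; left; apply/eqP; ring.
(* Bound for the interval of radius [3 * r] about 0, which contains [ball t r] when [|t| < 2 r]: the
   factor 3 comes from its length, [K] from replacing the power of [3 * r] by that of [|t| + r]. *)
pose C1 := 2 * (g + 1)^-1 * (3 * K).
have C10 : 0 < C1 by rewrite !mulr_gt0 ?invr_gt0.
exists (2 * K + C1); first by rewrite addr_gt0// mulr_gt0.
move=> t r r0.
have tr0 : 0 < `|t| + r by rewrite ltr_wpDl.
have [tr|tr] := leP (2 * r) `|t|.
  apply: (le_trans (far t r r0 _)).
    move=> s; rewrite /ball/= => ts.
    have := ler_distD t s 0; have := ler_distD s t 0.
    rewrite !subr0 (distrC s) => h1 h2.
    apply: powR_comparable; rewrite ?ler1n ?(ltW tr0)//; lra.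
  rewrite lee_fin ler_wpM2r ?mulr_ge0 ?powR_ge0 ?lerDl// ltW//.
have [g0|g0] := leP 0 g.
  apply: (le_trans (far t r r0 _)).
    move=> s; rewrite /ball/= => ts.
    apply: (@le_trans _ _ ((`|t| + r) `^ g)); last first.
      by rewrite ler_peMl ?powR_ge0// -[leLHS](powRr0 3) ler_powR// ler1n.
    apply: ge0_ler_powR => //; rewrite ?nnegrE ?normr_ge0//; first exact: ltW.
    have := ler_distD t s 0; rewrite !subr0 (distrC s); lra.
  rewrite lee_fin ler_wpM2r ?mulr_ge0 ?powR_ge0 ?lerDl// ltW//.
apply: (@le_trans _ _ (\int[lebesgue_measure]_(s in ball (0%R : R) (3 * r)%R)
    (`|s| `^ g)%:E)%E).
  apply: ge0_subset_integral => //; [exact: measurable_ball..| |].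
  - by apply: mp; exact: measurable_ball.
  - move=> s; rewrite /ball/= => ts; rewrite sub0r normrN.
    have := ler_distD t s 0; rewrite !subr0 (distrC s); lra.
apply: (le_trans (lebesgue_norm_powR_le _ _)) => //; first by rewrite mulr_gt0.
rewrite lee_fin.
have le3r : (3 * r) `^ g <= K * (`|t| + r) `^ g.
  by apply: powR_comparable; have := normr_ge0 t; lra.
apply: (@le_trans _ _ (C1 * ((`|t| + r) `^ g * r))); last first.
  by rewrite ler_wpM2r ?mulr_ge0 ?powR_ge0 ?lerDr// ltW// ?mulr_gt0.
rewrite /C1 -[leRHS]mulrA ler_wpM2l//; first by rewrite mulr_ge0 ?invr_ge0 ?ltW.
rewrite [leLHS]mulrCA -mulrA ler_wpM2l// mulrA.
by rewrite mulrC -[leRHS]mulrC; nra.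
Qed.

(** * Integration over products *)

(** Lebesgue measure in dimension [n.+1] is the image of a product measure under [snoc], so a change
    of variables followed by Tonelli separates the factors. *)
Lemma ge0_integral_rV_prod (R : realType) (n : nat) (A : set 'rV[R]_n) (B : set R)
    (f : 'rV[R]_n -> R) (g : R -> R) :
  measurable A -> measurable B ->
  measurable_fun setT f -> measurable_fun setT g ->
  (forall x, 0 <= f x) -> (forall t, 0 <= g t) ->
  (\int[lebesgue_rV n.+1]_(x in @proj_init R n @^-1` A `&` @proj_last R n @^-1` B)
     (f (proj_init x) * g (proj_last x))%:E =
   (\int[lebesgue_rV n]_(x in A) (f x)%:E) *
   (\int[lebesgue_measure]_(t in B) (g t)%:E))%E.
Proof.
move=> mA mB mf mg f0 g0.
have pi p : proj_init (@snoc R n p) = p.1 by rewrite -[in RHS](snocK p).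
have pl p : proj_last (@snoc R n p) = p.2 by rewrite -[in RHS](snocK p).
have mD : measurable (@proj_init R n @^-1` A `&` @proj_last R n @^-1` B).
  apply: measurableI; rewrite -[X in measurable X]setTI.
    exact: measurable_proj_init.
  exact: measurable_proj_last.
transitivity (\int[lebesgue_rV n \x (@lebesgue_measure R)]_(p in @snoc R n @^-1`
      (@proj_init R n @^-1` A `&` @proj_last R n @^-1` B))
     (f (proj_init (snoc p)) * g (proj_last (snoc p)))%:E)%E.
  have ms : measurable_fun setT
      (@snoc R n : ('rV[R]_n * measurableTypeR R)%type -> 'rV[R]_n.+1).
    exact: measurable_snoc.
  have H := @ge0_integral_pushforward _ _ _ _ _ _ ms
    (lebesgue_rV n \x (@lebesgue_measure R))%E _
    (fun x => (f (proj_init x) * g (proj_last x))%:E) mD.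
  apply: H; last by move=> x _; rewrite lee_fin mulr_ge0.
  apply/measurable_EFinP; apply: measurable_funTS; apply: measurable_funM.
    by apply: measurableT_comp => //; exact: measurable_proj_init.
  by apply: measurableT_comp => //; exact: measurable_proj_last.
(* Extension by zero turns the domain into the whole product while the integrand remains a product
   of functions of one component each. *)
pose fA := (fun x => (f x)%:E) \_ A.
pose gB := (fun x => (g x)%:E) \_ B.
have fA0 x : (0 <= fA x)%E by apply: erestrict_ge0 => y _; rewrite lee_fin.
have gB0 x : (0 <= gB x)%E by apply: erestrict_ge0 => y _; rewrite lee_fin.
have mfE : measurable_fun setT (fun x => (f x)%:E) by exact/measurable_EFinP.
have mfA : measurable_fun setT fA.
  exact: ((measurable_restrictT (fun x => (f x)%:E) mA).1 (measurable_funTS mfE)).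
have mgE : measurable_fun setT (fun x => (g x)%:E) by exact/measurable_EFinP.
have mgB : measurable_fun setT gB.
  exact: ((measurable_restrictT (fun x => (g x)%:E) mB).1 (measurable_funTS mgE)).
transitivity (\int[lebesgue_rV n \x (@lebesgue_measure R)]_p (fA p.1 * gB p.2))%E.
  rewrite integral_mkcond; apply: eq_integral => -[x t] _.
  rewrite /fA /gB /patch/=.
  rewrite (_ : _ \in _ = (x \in A) && (t \in B)); last first.
    apply/idP/andP; rewrite !inE /= ?pi ?pl //=.
  by case: (x \in A) => /=; case: (t \in B) => /=; rewrite ?mul0e ?mule0// pi pl.
rewrite fubini_tonelli1/=; first last.
- by move=> p; rewrite mule_ge0.
- apply: emeasurable_funM; apply: measurableT_comp => //.
rewrite /fubini_F/=.
under eq_integral do rewrite ge0_integralZl//.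
rewrite ge0_integralZr//; last by apply: integral_ge0.
by rewrite -!integral_mkcond.
Qed.

(** * Sup-norm cubes, their volume, and null sets *)

Section sup_norm.
Context {R : realType}.

Lemma rV_norm_leP n (x : 'rV[R]_n) (c : R) : 0 <= c ->
  reflect (forall i, `|x ord0 i| <= c) (`|x| <= c).
Proof.
move=> c0; rewrite -[`|x|]/(mx_norm x) mx_normrE; apply: (iffP (bigmax_leP _ _ _ _)).
  by move=> [_ h] i; exact: (h (ord0, i)).
by move=> h; split=> // -[i j] _; rewrite ord1; exact: h.
Qed.

Lemma rV_norm_ge_coord n (x : 'rV[R]_n) i : `|x ord0 i| <= `|x|.
Proof. by move: i; apply/rV_norm_leP. Qed.

Lemma rV_norm_snoc n (x : 'rV[R]_n.+1) :
  `|x| = Num.max `|proj_init x| `|proj_last x|.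
Proof.
apply/eqP; rewrite eq_le; apply/andP; split.
  apply/rV_norm_leP => [|i]; first by rewrite le_max normr_ge0.
  rewrite le_max; have [->|[j ->]] : i = ord_max \/ exists j, i = lift ord_max j.
    by case: (unliftP ord_max i) => [j ->|->]; [right; exists j|left].
  - by rewrite lexx orbT.
  - apply/orP; left; rewrite (le_trans _ (rV_norm_ge_coord (proj_init x) j))//.
    by rewrite mxE.
rewrite ge_max rV_norm_ge_coord andbT; apply/rV_norm_leP => // i.
by rewrite mxE rV_norm_ge_coord.
Qed.

Lemma rV_ballE n (x : 'rV[R]_n) r : ball x r = [set y | `|x - y| < r].
Proof. by rewrite -[ball]/(@ball _ _) mx_norm_ball. Qed.

Lemma proj_initB n (x y : 'rV[R]_n.+1) :
  proj_init (x - y) = proj_init x - proj_init y.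
Proof. by apply/rowP => i; rewrite !mxE. Qed.

Lemma proj_lastB n (x y : 'rV[R]_n.+1) :
  proj_last (x - y) = proj_last x - proj_last y.
Proof. by rewrite /proj_last !mxE. Qed.

(** The reason for working with the sup norm: its balls are products, so integrals over them factor
    by [ge0_integral_rV_prod]. *)
Lemma rV_ball_snoc n (x : 'rV[R]_n.+1) r :
  ball x r = @proj_init R n @^-1` ball (proj_init x) r `&`
             @proj_last R n @^-1` ball (proj_last x) r.
Proof.
rewrite !rV_ballE; apply/seteqP; split => y /=;
  rewrite rV_norm_snoc gt_max proj_initB proj_lastB.
  by move/andP.
by move=> [h1 h2]; rewrite h1.
Qed.

Lemma measurable_rV_ball n (x : 'rV[R]_n) r : measurable (ball x r).
Proof. by apply: open_measurable_rV; exact: ball_open. Qed.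

Lemma measurable_rV_norm n : measurable_fun setT (fun x : 'rV[R]_n => `|x|).
Proof.
elim: n => [|n IH].
  rewrite (_ : (fun _ => _) = cst 0); first exact: measurable_cst.
  by apply/funext => x; rewrite thinmx0 normr0.
under eq_fun do rewrite rV_norm_snoc.
apply: measurable_maxr.
  by apply: measurableT_comp => //; exact: measurable_proj_init.
apply: measurableT_comp; first exact: normr_measurable.
exact: measurable_proj_last.
Qed.

Let measurable_box n (a b : 'rV[R]_n) :
  measurable [set x : 'rV[R]_n | forall i, x ord0 i \in `]a ord0 i, b ord0 i]].
Proof.
rewrite [X in measurable X](_ : _ = \bigcap_(i in [set: 'I_n])
    ((fun x : 'rV[R]_n => x ord0 i) @^-1` [set` `]a ord0 i, b ord0 i]])).
  apply: fin_bigcap_measurable => [|i _]; first exact: finite_finset.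
  by rewrite -[X in measurable X]setTI; apply: measurable_coord.
by apply/seteqP; split=> [x xA i _|x xA i]; [exact: xA|exact: (xA i)].
Qed.

Lemma lebesgue_rV_ball_le n (x : 'rV[R]_n) r : 0 < r ->
  (lebesgue_rV n (ball x r) <= ((2 * r) ^+ n)%:E)%E.
Proof.
move=> r0; pose a := x - const_mx r; pose b := x + const_mx r.
rewrite (_ : (2 * r) ^+ n = \prod_(i < n) (b ord0 i - a ord0 i)); last first.
  rewrite (eq_bigr (fun=> 2 * r)) ?prodr_const ?card_ord// => i _.
  by rewrite !mxE; ring.
rewrite -lebesgue_rV_box => [|i]; last by rewrite !mxE; lra.
apply: le_measure; rewrite ?inE; [exact: measurable_rV_ball|exact: measurable_box|].
rewrite rV_ballE => y /= xy i; have := rV_norm_ge_coord (x - y) i.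
rewrite !mxE in_itv/= => h; have := le_lt_trans h xy.
by rewrite ltr_norml; lra.
Qed.

Lemma lebesgue_rV_ball_ge n (x : 'rV[R]_n) r : 0 < r ->
  ((r ^+ n)%:E <= lebesgue_rV n (ball x r))%E.
Proof.
(* Half-side [r / 2]: the box contains part of its boundary and must fit in an open cube. The volume
   lost is only a dimensional factor. *)
move=> r0; pose a := x - const_mx (r / 2); pose b := x + const_mx (r / 2).
rewrite (_ : r ^+ n = \prod_(i < n) (b ord0 i - a ord0 i)); last first.
  rewrite (eq_bigr (fun=> r)) ?prodr_const ?card_ord// => i _.
  by rewrite !mxE; lra.
rewrite -lebesgue_rV_box => [|i]; last by rewrite !mxE; lra.
apply: le_measure; rewrite ?inE; [exact: measurable_box|exact: measurable_rV_ball|].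
rewrite rV_ballE => y /= yab; apply: (@le_lt_trans _ _ (r / 2)); last lra.
apply/rV_norm_leP => [|i]; first lra.
by have := yab i; rewrite !mxE in_itv/= ler_norml; lra.
Qed.

Lemma lebesgue_rV_last_eq0 n :
  lebesgue_rV n.+1 [set x : 'rV[R]_n.+1 | proj_last x = 0] = 0%E.
Proof.
rewrite /= /lebesgue_snoc /pushforward.
rewrite (_ : _ @^-1` _ = [set: 'rV[R]_n] `*` [set 0]); last first.
  by apply/seteqP; split => -[v t] /=; rewrite /proj_last mxE unlift_none//= => -[].
transitivity (lebesgue_rV n setT * lebesgue_measure [set (0%R : R)])%E.
  exact: product_measure1E.
by rewrite [X in (_ * X)%E](_ : _ = 0%E) ?mule0//; exact: lebesgue_measure_set1.
Qed.

Lemma negligible_last_eq0 n :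
  (lebesgue_rV n.+1).-negligible [set x : 'rV[R]_n.+1 | proj_last x = 0].
Proof.
exists [set x : 'rV[R]_n.+1 | proj_last x = 0]; split => //.
  rewrite [X in measurable X](_ : _ = @proj_last R n @^-1` [set 0])//.
  by rewrite -[X in measurable X]setTI; exact: measurable_proj_last.
exact: lebesgue_rV_last_eq0.
Qed.

(** The origin of the space of [x'] lies in the null set where the last coordinate of [x'] vanishes.
    In dimension 0 the origin is the whole space and has mass 1, whence [0 < n]. *)
Lemma negligible_init_eq0 n : (0 < n)%N ->
  (lebesgue_rV n.+1).-negligible [set x : 'rV[R]_n.+1 | proj_init x = 0].
Proof.
case: n => // n _.
have m0 : measurable [set 0 : 'rV[R]_n.+1].
  rewrite (_ : [set 0] = (fun x : 'rV[R]_n.+1 => `|x|) @^-1` [set 0]).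
    by rewrite -[X in measurable X]setTI; exact: measurable_rV_norm.
  by apply/seteqP; split=> x /= => [->|/eqP]; rewrite ?normr0// normr_eq0 => /eqP.
exists [set x : 'rV[R]_n.+2 | proj_init x = 0]; split => //.
  rewrite [X in measurable X](_ : _ = @proj_init R n.+1 @^-1` [set 0])//.
  by rewrite -[X in measurable X]setTI; exact: measurable_proj_init.
rewrite /= /lebesgue_snoc /pushforward.
rewrite (_ : _ @^-1` _ = [set 0 : 'rV[R]_n.+1] `*` [set: R]); last first.
  apply/seteqP; split => -[v t] /=; have /(congr1 fst)/= -> := snocK (v, t) => //.
  by case.
transitivity (lebesgue_rV n.+1 [set 0%R] * lebesgue_measure [set: R])%E.
  exact: product_measure1E.
rewrite [X in (X * _)%E](_ : _ = 0%E) ?mul0e//.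
apply/eqP; rewrite eq_le measure_ge0 andbT -(lebesgue_rV_last_eq0 n).
apply: le_measure; rewrite ?inE//.
  rewrite [X in measurable X](_ : _ = @proj_last R n @^-1` [set 0])//.
  by rewrite -[X in measurable X]setTI; exact: measurable_proj_last.
by move=> x /= ->; rewrite /proj_last mxE.
Qed.

End sup_norm.

(** * Upper bounds for the weighted mass of a cube *)

Lemma ler_powR_le0 (R : realType) (u v b : R) :
  0 < u -> u <= v -> b <= 0 -> v `^ b <= u `^ b.
Proof.
move=> u0 uv b0; have v0 := lt_le_trans u0 uv.
rewrite -(opprK b) !(powRN _ (- b)) lef_pV2 ?posrE ?powR_gt0//.
by rewrite ge0_ler_powR ?oppr_ge0// nnegrE ltW.
Qed.

Section upper_bound.
Context {R : realType}.

(** Upper half of the mass comparison for a power of a single norm, stated as a predicate because it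
    is what the induction on the dimension carries. *)
Definition norm_powR_bound n (a : R) : Prop :=
  exists2 C : R, 0 < C & forall (x : 'rV[R]_n) (r : R), 0 < r ->
  (\int[lebesgue_rV n]_(y in ball x r) (`|y| `^ a)%:E <=
   (C * ((`|x| + r) `^ a * r ^+ n))%:E)%E.

Let mnorm n (a : R) : measurable_fun setT (fun y : 'rV[R]_n => `|y| `^ a).
Proof.
by apply: (measurableT_comp (measurable_powR a)); exact: measurable_rV_norm.
Qed.

Let mnormR (a : R) : measurable_fun setT (fun y : R => `|y| `^ a).
Proof.
by apply: (measurableT_comp (measurable_powR a)); exact: normr_measurable.
Qed.

Let minit n (a : R) : measurable_fun setT (fun y : 'rV[R]_n.+1 => `|proj_init y| `^ a).
Proof. by apply: (measurableT_comp (mnorm a)); exact: measurable_proj_init. Qed.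

Let mlast n (a : R) : measurable_fun setT (fun y : 'rV[R]_n.+1 => `|proj_last y| `^ a).
Proof. by apply: (measurableT_comp (mnormR a)); exact: measurable_proj_last. Qed.

Lemma rV_norm_ge_init n (x : 'rV[R]_n.+1) : `|proj_init x| <= `|x|.
Proof. by rewrite rV_norm_snoc le_max lexx. Qed.

Lemma rV_norm_ge_last n (x : 'rV[R]_n.+1) : `|proj_last x| <= `|x|.
Proof. by rewrite rV_norm_snoc le_max lexx orbT. Qed.

(** Without the mixed factor [|y|] the integral over a cube is the product of one in [y'] and one in
    the last coordinate. *)
Lemma norm_powR_prod_bound n (a c : R) : norm_powR_bound n a -> - 1 < c ->
  exists2 C : R, 0 < C & forall (x : 'rV[R]_n.+1) (r : R), 0 < r ->
  (\int[lebesgue_rV n.+1]_(y in ball x r)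
     (`|proj_init y| `^ a * `|proj_last y| `^ c)%:E <=
   (C * ((`|proj_init x| + r) `^ a * (`|proj_last x| + r) `^ c * r ^+ n.+1))%:E)%E.
Proof.
move=> [C1 C10 H1] c1; have [C2 C20 H2] := lebesgue_powR_ball_le c1.
exists (C1 * C2); first by rewrite mulr_gt0.
move=> x r r0; rewrite rV_ball_snoc.
rewrite (ge0_integral_rV_prod (f := fun y => `|y| `^ a) (g := fun t => `|t| `^ c))//.
- apply: (le_trans (lee_pmul _ _ (H1 (proj_init x) r r0) (H2 (proj_last x) r r0))).
  + by apply: integral_ge0 => y _; rewrite lee_fin powR_ge0.
  + by apply: integral_ge0 => y _; rewrite lee_fin powR_ge0.
  + rewrite -EFinM lee_fin exprSr le_eqVlt; apply/orP; left; apply/eqP.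
    ring.
- exact: measurable_rV_ball.
- exact: measurable_ball.
Qed.

(** The splitting [b = b1 + b2] is left abstract because it is chosen twice: for [a = c = 0] in the
    induction on the dimension, and for the full weight. The last alternative admits [n = 0], where
    the induction begins: there [|y'|] is identically 0, and its exponents are required to vanish so
    that its powers equal 1. *)
Lemma power_weight_ball_le n (a b c b1 b2 : R) : norm_powR_bound n a -> - 1 < c ->
  0 <= b \/ [/\ b1 <= 0, b2 <= 0, b = b1 + b2, norm_powR_bound n (a + b1) &
    - 1 < c + b2 /\ ((0 < n)%N \/ a = 0 /\ b1 = 0)] ->
  exists2 C : R, 0 < C & forall (x : 'rV[R]_n.+1) (r : R), 0 < r ->
  (\int[lebesgue_rV n.+1]_(y in ball x r)
     (`|proj_init y| `^ a * `|y| `^ b * `|proj_last y| `^ c)%:E <=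
   (C * ((`|proj_init x| + r) `^ a * (`|x| + r) `^ b *
         (`|proj_last x| + r) `^ c * r ^+ n.+1))%:E)%E.
Proof.
move=> Ha c1 Hb; have [C1 C10 H1] := norm_powR_prod_bound Ha c1.
pose K := (3 : R) `^ `|b|.
have K0 : 0 < K by rewrite powR_gt0.
have mw (A : set 'rV[R]_n.+1) : measurable A ->
    measurable_fun A (fun y : 'rV[R]_n.+1 =>
     (`|proj_init y| `^ a * `|y| `^ b * `|proj_last y| `^ c)%:E).
  move=> mA; apply/measurable_EFinP; apply: measurable_funTS.
  by apply: measurable_funM => //; apply: measurable_funM.
have w0 (y : 'rV[R]_n.+1) : 0 <= `|proj_init y| `^ a * `|y| `^ b * `|proj_last y| `^ c.
  by rewrite !mulr_ge0 ?powR_ge0.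
have far (x : 'rV[R]_n.+1) (r : R) : 0 < r ->
    (forall y, ball x r y -> `|y| `^ b <= K * (`|x| + r) `^ b) ->
  (\int[lebesgue_rV n.+1]_(y in ball x r)
     (`|proj_init y| `^ a * `|y| `^ b * `|proj_last y| `^ c)%:E <=
   ((K * C1) * ((`|proj_init x| + r) `^ a * (`|x| + r) `^ b *
         (`|proj_last x| + r) `^ c * r ^+ n.+1))%:E)%E.
  move=> r0 xy.
  apply: (@le_trans _ _ (\int[lebesgue_rV n.+1]_(y in ball x r)
     ((K * (`|x| + r) `^ b)%:E * (`|proj_init y| `^ a * `|proj_last y| `^ c)%:E))%E).
    apply: ge0_le_integral.
    - exact: measurable_rV_ball.
    - by move=> y _; rewrite lee_fin.
    - by apply: mw; exact: measurable_rV_ball.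
    - under eq_fun do rewrite -EFinM.
      apply/measurable_EFinP; apply: measurable_funTS.
      apply: measurable_funM => //; exact: measurable_funM.
    - move=> y /xy yb; rewrite -EFinM lee_fin mulrAC mulrC.
      by rewrite ler_wpM2r// mulr_ge0 ?powR_ge0.
  rewrite ge0_integralZl_EFin; first last.
  - by rewrite mulr_ge0 ?powR_ge0 ?ltW.
  - by apply/measurable_EFinP; apply: measurable_funTS; exact: measurable_funM.
  - by move=> y _; rewrite lee_fin mulr_ge0 ?powR_ge0.
  - exact: measurable_rV_ball.
  have Kb : (0 <= (K * (`|x| + r) `^ b)%:E)%E.
    by rewrite lee_fin mulr_ge0 ?powR_ge0 ?ltW.
  apply: (le_trans (lee_wpmul2l Kb (H1 x r r0))).
  by rewrite -EFinM lee_fin le_eqVlt; apply/orP; left; apply/eqP; ring.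
have KC : 0 < K * C1 by rewrite mulr_gt0.
have tri (x : 'rV[R]_n.+1) r y : ball x r y -> `|y| <= `|x| + r /\ `|x| - r <= `|y|.
  rewrite rV_ballE/= => xy; have := ler_distD x y 0; have := ler_distD y x 0.
  by rewrite !subr0 (distrC y); lra.
have [b0|[b10 b20 bE Hab [c21 n0]]] : 0 <= b \/ _ := Hb.
  exists (K * C1) => // x r r0; apply: far => // y /tri[h _].
  apply: (@le_trans _ _ ((`|x| + r) `^ b)); last first.
    by rewrite ler_peMl ?powR_ge0// -[leLHS](powRr0 3) ler_powR// ler1n.
  by apply: ge0_ler_powR => //; rewrite nnegrE ?(le_trans _ h).
have [C2 C20 H2] := norm_powR_prod_bound Hab c21.
pose K' : R := 3 `^ `|b1| * 3 `^ `|b2|.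
have K'0 : 0 < K' by rewrite mulr_gt0 ?powR_gt0.
have KC2 : 0 < K' * C2 by rewrite mulr_gt0.
exists (K * C1 + K' * C2); first by rewrite addr_gt0.
move=> x r r0; have xr0 : 0 < `|x| + r by rewrite ltr_wpDl.
have i0 : 0 < `|proj_init x| + r by rewrite ltr_wpDl.
have l0 : 0 < `|proj_last x| + r by rewrite ltr_wpDl.
have M0 : 0 <= (`|proj_init x| + r) `^ a * (`|x| + r) `^ b *
         (`|proj_last x| + r) `^ c * r ^+ n.+1.
  by rewrite !mulr_ge0 ?powR_ge0// exprn_ge0// ltW.
(* Far from the origin [|y|] is comparable to [|x| + r] on the whole cube, so its power factors out
   whatever the sign of [b]. *)
have [xr|xr] := leP (2 * r) `|x|.
  apply: (le_trans (far x r r0 _)).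
    move=> y /tri[h1 h2]; apply: powR_comparable => //; lra.
  by rewrite lee_fin ler_wpM2r// lerDl ltW.
apply: (@le_trans _ _ (\int[lebesgue_rV n.+1]_(y in ball x r)
     (`|proj_init y| `^ (a + b1) * `|proj_last y| `^ (c + b2))%:E)%E).
  (* Only almost everywhere: [0 `^ b1 = 0] for b1 < 0. *)
  apply: ae_ge0_le_integral.
  - exact: measurable_rV_ball.
  - by move=> y _; rewrite lee_fin.
  - by apply: mw; exact: measurable_rV_ball.
  - by move=> y _; rewrite lee_fin mulr_ge0 ?powR_ge0.
  - by apply/measurable_EFinP; apply: measurable_funTS; exact: measurable_funM.
  have aeL : {ae lebesgue_rV n.+1, forall y : 'rV[R]_n.+1, proj_last y != 0}.
    apply: negligibleS (negligible_last_eq0 n) => y /=.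
    by move/negP; rewrite negbK => /eqP.
  have aeI : {ae lebesgue_rV n.+1, forall y : 'rV[R]_n.+1,
      proj_init y != 0 \/ (a = 0 /\ b1 = 0)}.
    case: n0 => [n0|ab]; last by apply: aeW => y; right.
    apply: negligibleS (negligible_init_eq0 n0) => y /=.
    by apply: contra_notP => /eqP; left.
  apply: filterS2 aeL aeI => y yl yi _; rewrite lee_fin.
  have yl0 : 0 < `|proj_last y| by rewrite normr_gt0.
  have y0 := lt_le_trans yl0 (rV_norm_ge_last y).
  rewrite bE powRD ?(gt_eqF y0) ?implybT//.
  rewrite (_ : `|proj_last y| `^ (c + b2) =
    `|proj_last y| `^ c * `|proj_last y| `^ b2); last first.
    by apply: powRD; rewrite (gt_eqF yl0) implybT.
  have -> : `|proj_init y| `^ (a + b1) = `|proj_init y| `^ a * `|proj_init y| `^ b1.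
    case: yi => [yi|[-> ->]]; last by rewrite addr0 powRr0 mulr1.
    by rewrite powRD// normr_eq0 yi implybT.
  have h1 : `|y| `^ b1 <= `|proj_init y| `^ b1.
    case: yi => [yi|[_ ->]]; last by rewrite !powRr0.
    by rewrite ler_powR_le0 ?normr_gt0 ?rV_norm_ge_init.
  have h2 : `|y| `^ b2 <= `|proj_last y| `^ b2.
    by rewrite ler_powR_le0 ?normr_gt0 ?rV_norm_ge_last.
  rewrite [leLHS](_ : _ = (`|proj_init y| `^ a * `|proj_last y| `^ c) *
    (`|y| `^ b1 * `|y| `^ b2)); last by ring.
  rewrite [leRHS](_ : _ = (`|proj_init y| `^ a * `|proj_last y| `^ c) *
    (`|proj_init y| `^ b1 * `|proj_last y| `^ b2)); last by ring.
  by rewrite ler_wpM2l ?mulr_ge0 ?powR_ge0// ler_pM ?powR_ge0.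
apply: (le_trans (H2 x r r0)); rewrite lee_fin.
apply: (@le_trans _ _ (K' * C2 * ((`|proj_init x| + r) `^ a * (`|x| + r) `^ b *
         (`|proj_last x| + r) `^ c * r ^+ n.+1))); last first.
  by rewrite ler_wpM2r// lerDr ltW.
have hx := rV_norm_ge_init x; have hl := rV_norm_ge_last x.
have hx0 := normr_ge0 (proj_init x); have hl0 := normr_ge0 (proj_last x).
(* Since [|x| < 2 r], all three of [|proj_init x| + r], [|proj_last x| + r] and [|x| + r] lie
   between [r] and [3 r]; this reassembles the split powers into one of [|x| + r]. *)
have h1 : (`|proj_init x| + r) `^ b1 <= 3 `^ `|b1| * (`|x| + r) `^ b1.
  by apply: powR_comparable; lra.
have h2 : (`|proj_last x| + r) `^ b2 <= 3 `^ `|b2| * (`|x| + r) `^ b2.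
  by apply: powR_comparable; lra.
rewrite bE !powRD ?(gt_eqF xr0) ?(gt_eqF i0) ?(gt_eqF l0) ?implybT// /K'.
set A := _ `^ a; set D := (_ + r) `^ c.
set u1 := _ `^ b1 in h1 *; set u2 := _ `^ b2 in h2 *.
set v1 := _ `^ b1 in h1 *; set v2 := _ `^ b2 in h2 *.
rewrite [leLHS](_ : _ = (C2 * A * D * r ^+ n.+1) * (u1 * u2)); last by ring.
rewrite [leRHS](_ : _ = (C2 * A * D * r ^+ n.+1) *
  ((3 `^ `|b1| * v1) * (3 `^ `|b2| * v2))); last by ring.
rewrite ler_wpM2l ?ler_pM ?powR_ge0//.
by rewrite !mulr_ge0 ?powR_ge0 ?exprn_ge0 ?ltW.
Qed.

(** Induction on the dimension. The alternative [a = 0] is there for dimension 0, where the strict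
    inequality excludes it although the bound holds. *)
Lemma norm_powR_bound_gt n (a : R) : - n%:R < a \/ a = 0 -> norm_powR_bound n a.
Proof.
(* For a nonnegative exponent [|y| <= |x| + r] bounds the integrand, and [2 ^+ m] comes from the
   volume of the cube. *)
have pos m (b : R) : 0 <= b -> norm_powR_bound m b.
  move=> b0; exists (2 ^+ m); first by rewrite exprn_gt0.
  move=> x r r0.
  apply: (@le_trans _ _ (\int[lebesgue_rV m]_(y in ball x r) ((`|x| + r) `^ b)%:E)%E).
    apply: ge0_le_integral.
    - exact: measurable_rV_ball.
    - by move=> y _; rewrite lee_fin powR_ge0.
    - by apply/measurable_EFinP; exact: measurable_funTS.
    - exact: measurable_cst.
    - move=> y; rewrite rV_ballE/= => xy; rewrite lee_fin.
      have h : `|y| <= `|x| + r.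
        by have := ler_distD x y 0; rewrite !subr0 (distrC y); lra.
      by apply: ge0_ler_powR => //; rewrite nnegrE ?(le_trans _ h).
  rewrite [leLHS]integral_cst; last exact: measurable_rV_ball.
  have p0 : (0 <= ((`|x| + r) `^ b)%:E)%E by rewrite lee_fin powR_ge0.
  apply: (le_trans (lee_wpmul2l p0 (lebesgue_rV_ball_le x r0))).
  by rewrite -EFinM lee_fin exprMn le_eqVlt; apply/orP; left; apply/eqP; ring.
elim: n a => [|n IH] a [an|->]; do ?[exact: pos].
  by apply: pos; rewrite ltW// -oppr0.
have [a0|a0] := leP 0 a; first exact: pos.
(* Splitting in the ratio n : 1 shares the condition [a > -(n+1)] evenly: [b2 > -1] and
   [b1 = n b2 > -n]. For [n = 0] this gives [b1 = 0], the exceptional alternative. *)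
pose b1 := a * n%:R / n.+1%:R; pose b2 := a / n.+1%:R.
have n1 : 0 < n.+1%:R :> R by [].
have bE : a = b1 + b2.
  by rewrite /b1 /b2 -mulrDl -[X in _ + X]mulr1 -mulrDr natr1 mulfK ?gt_eqF.
have b21 : - 1 < 0 + b2.
  by rewrite add0r ltr_pdivlMr// mulN1r.
have b10 : b1 <= 0.
  by rewrite /b1 -mulrA mulr_le0_ge0 ?divr_ge0// ltW.
have b20 : b2 <= 0 by rewrite /b2 mulr_le0_ge0 ?invr_ge0// ltW.
have [|||C C0 HC] := @power_weight_ball_le n 0 a 0 b1 b2.
- by apply: IH; right.
- lra.
- right; split=> //; last first.
    split=> //; case: (posnP n) => [n0|]; [right|by left].
    by rewrite /b1 n0 mulr0 mul0r.
  apply: IH; rewrite add0r; case: (posnP n) => [n0|n0]; last left.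
    by right; rewrite /b1 n0 mulr0 mul0r.
  have {}n0 : 0 < n%:R :> R by rewrite ltr0n.
  rewrite /b1 mulrAC -/b2 -mulN1r ltr_pM2r//; lra.
exists C => // x r r0; have := HC x r r0.
rewrite !powRr0 mul1r mulr1.
under eq_integral do rewrite !powRr0 mul1r mulr1.
by [].
Qed.

End upper_bound.

(** * Two-sided mass bounds for cubes, and the doubling property *)

Section doubling.
Context {R : realType}.

Lemma enorm_ge0 n (x : 'rV[R]_n) : 0 <= enorm x.
Proof. exact: sqrtr_ge0. Qed.

Lemma rV_norm_le_enorm n (x : 'rV[R]_n) : `|x| <= enorm x.
Proof.
apply/rV_norm_leP => [|i]; first exact: enorm_ge0.
rewrite -sqrtr_sqr ler_wsqrtr// (bigD1 i)//= lerDl.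
by apply: sumr_ge0 => j _; exact: sqr_ge0.
Qed.

Lemma enorm_le_rV_norm n (x : 'rV[R]_n) : enorm x <= n.+1%:R * `|x|.
Proof.
have h0 : 0 <= n.+1%:R * `|x| by rewrite mulr_ge0.
rewrite -(ger0_norm h0) -sqrtr_sqr ler_wsqrtr//.
apply: (@le_trans _ _ (\sum_(i < n) `|x| ^+ 2)).
  apply: ler_sum => i _; rewrite -real_normK ?num_real//.
  by rewrite lerXn2r ?nnegrE// rV_norm_ge_coord.
rewrite sumr_const card_ord -[leLHS]mulr_natl exprMn ler_wpM2r ?sqr_ge0//.
by rewrite -natrX ler_nat expnS expn1 (leq_trans (leqnSn n))// leq_pmulr.
Qed.

(** The sup-norm counterpart of [weight], adapted to integration over cubes. *)
Definition power_weight n (a b c : R) (y : 'rV[R]_n.+1) : R :=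
  `|proj_init y| `^ a * `|y| `^ b * `|proj_last y| `^ c.

(** The model mass M(x, r). *)
Definition ball_mass n (a b c : R) (x : 'rV[R]_n.+1) (r : R) : R :=
  (`|proj_init x| + r) `^ a * (`|x| + r) `^ b * (`|proj_last x| + r) `^ c * r ^+ n.+1.

Lemma weight_power_weight n (a b c : R) : exists2 L : R, 0 < L &
  forall y : 'rV[R]_n.+1, weight (a, b, c) y <= L * power_weight a b c y /\
    power_weight a b c y <= L * weight (a, b, c) y.
Proof.
(* The constant of [enorm_le_rV_norm] in dimension [n.+1]; it also exceeds the one in dimension [n],
   needed for [y']. *)
pose K : R := n.+2%:R.
have K1 : 1 <= K by rewrite ler1n.
have K0 := lt_le_trans ltr01 K1.
exists (K `^ `|a| * K `^ `|b|); first by rewrite mulr_gt0 ?powR_gt0.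
move=> y; pose y' := proj_init y.
have e1 : enorm y' <= K * `|y'|.
  by rewrite (le_trans (enorm_le_rV_norm _))// ler_wpM2r// ler_nat.
have e2 : enorm y <= K * `|y| := enorm_le_rV_norm y.
have e1' : `|y'| <= K * enorm y'.
  by rewrite (le_trans (rV_norm_le_enorm y'))// ler_peMl// enorm_ge0.
have e2' : `|y| <= K * enorm y.
  by rewrite (le_trans (rV_norm_le_enorm y))// ler_peMl// enorm_ge0.
have e1'' : `|y'| `^ a <= K `^ `|a| * enorm y' `^ a.
  by apply: powR_comparable => //; exact: enorm_ge0.
have f1'' : enorm y' `^ a <= K `^ `|a| * `|y'| `^ a.
  by apply: powR_comparable => //; exact: enorm_ge0.
have e2'' : `|y| `^ b <= K `^ `|b| * enorm y `^ b.
  by apply: powR_comparable => //; exact: enorm_ge0.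
have f2'' : enorm y `^ b <= K `^ `|b| * `|y| `^ b.
  by apply: powR_comparable => //; exact: enorm_ge0.
by split; rewrite /= /power_weight mulrA ler_wpM2r ?powR_ge0// mulrACA ler_pM ?powR_ge0.
Qed.

Lemma measurable_power_weight n (a b c : R) (A : set 'rV[R]_n.+1) :
  measurable A -> measurable_fun A (fun y => (power_weight a b c y)%:E).
Proof.
move=> mA; apply/measurable_EFinP; apply: measurable_funTS.
apply: measurable_funM; first apply: measurable_funM.
- apply: (measurableT_comp (measurable_powR a)).
  by apply: (measurableT_comp (@measurable_rV_norm R n)); exact: measurable_proj_init.
- by apply: (measurableT_comp (measurable_powR b)); exact: measurable_rV_norm.
- apply: (measurableT_comp (measurable_powR c)).
  by apply: measurableT_comp; [exact: normr_measurable|exact: measurable_proj_last].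
Qed.

Lemma power_weight_ge0 n (a b c : R) (y : 'rV[R]_n.+1) : 0 <= power_weight a b c y.
Proof. by rewrite !mulr_ge0 ?powR_ge0. Qed.

Lemma ball_mass_ge0 n (a b c : R) (x : 'rV[R]_n.+1) r :
  0 < r -> 0 <= ball_mass a b c x r.
Proof. by move=> r0; rewrite !mulr_ge0 ?powR_ge0// exprn_ge0// ltW. Qed.

(** Only a subcube of half-side [r / 4] is kept. On it the integrand is at least the product of the
    three powers in M divided by [K], and its volume is at least [(r / 4) ^+ n.+1]; this explains
    the constant. *)
Lemma ball_mass_le_integral n (a b c : R) : (0 < n)%N -> exists2 C : R, 0 < C &
  forall (x : 'rV[R]_n.+1) (r : R), 0 < r ->
  ((ball_mass a b c x r)%:E <=
   C%:E * \int[lebesgue_rV n.+1]_(y in ball x r) (power_weight a b c y)%:E)%E.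
Proof.
move=> n0.
pose K : R := 4 `^ `|a| * 4 `^ `|b| * 4 `^ `|c|.
have K0 : 0 < K by rewrite !mulr_gt0 ?powR_gt0.
exists (4 ^+ n.+1 * K); first by rewrite mulr_gt0 ?exprn_gt0.
move=> x r r0.
(* Moving each coordinate away from 0 by [r / 2] leaves a margin of [r / 4] in the subcube:
   [|z_i| >= |x_i| + r / 4], hence [|x_i| + r <= 4 |z_i|]. *)
pose y : 'rV[R]_n.+1 :=
  \row_i (x ord0 i + (if 0 <= x ord0 i then r / 2 else - (r / 2))).
have r40 : 0 < r / 4 by rewrite divr_gt0.
have xy i : `|x ord0 i - y ord0 i| <= r / 2 /\ `|x ord0 i| + r / 2 <= `|y ord0 i|.
  rewrite mxE; case: ifPn => [x0|]; [|rewrite -ltNge => x0]; split.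
  - by rewrite ler_norml; lra.
  - by rewrite (ger0_norm x0) ger0_norm; lra.
  - by rewrite ler_norml; lra.
  - by rewrite (ltr0_norm x0) ltr0_norm; lra.
have yx : ball y (r / 4) `<=` ball x r.
  move=> z; rewrite !rV_ballE/= => yz.
  have h : `|x - y| <= r / 2.
    by apply/rV_norm_leP => [|i]; [lra|rewrite !mxE; have [] := xy i; rewrite !mxE].
  have := ler_distD y x z; lra.
have xz z : ball y (r / 4) z -> forall i, `|x ord0 i| + r <= 4 * `|z ord0 i|.
  rewrite rV_ballE/= => yz i; have := rV_norm_ge_coord (y - z) i.
  have := ler_distD (z ord0 i) (y ord0 i) 0; have [_] := xy i.
  have -> : (y - z) ord0 i = y ord0 i - z ord0 i by rewrite [LHS]mxE [X in _ + X]mxE.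
  by rewrite !subr0; have := normr_ge0 (x ord0 i); lra.
(* At least one coordinate is required: with none, the left side is [r] and the right side 0.
   Applied to [x'], this is where [0 < n] enters. *)
have sup m (u v : 'rV[R]_m) : (0 < m)%N ->
    (forall i, `|u ord0 i| + r <= 4 * `|v ord0 i|) -> `|u| + r <= 4 * `|v|.
  move=> m0 uv; rewrite -lerBrDr; apply/rV_norm_leP => [|i].
    have i := Ordinal m0; have := uv i; have := rV_norm_ge_coord v i.
    have := normr_ge0 (u ord0 i); lra.
  have := uv i; have := rV_norm_ge_coord v i; lra.
pose V := (`|proj_init x| + r) `^ a * (`|x| + r) `^ b * (`|proj_last x| + r) `^ c.
have V0 : 0 <= V by rewrite !mulr_ge0 ?powR_ge0.
have Vz z : ball y (r / 4) z -> V <= K * power_weight a b c z.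
  move=> yz; have := xz z yz; move/yx : (yz) => + h.
  rewrite rV_ball_snoc !rV_ballE /ball/= => -[hi hl].
  have dist (U : normedZmodType R) (u v : U) : `|u - v| < r -> `|v| <= 4 * (`|u| + r).
    by have := ler_distD u v 0; rewrite !subr0 (distrC v); have := normr_ge0 u; lra.
  have hx : `|x - z| < r by rewrite rV_norm_snoc gt_max proj_initB proj_lastB hi hl.
  have p1 : (`|proj_init x| + r) `^ a <= 4 `^ `|a| * `|proj_init z| `^ a.
    apply: powR_comparable; rewrite ?ler1n ?addr_ge0 ?(ltW r0) ?dist//.
    by apply: sup => // i; rewrite !mxE.
  have p2 : (`|x| + r) `^ b <= 4 `^ `|b| * `|z| `^ b.
    by apply: powR_comparable; rewrite ?ler1n ?addr_ge0 ?(ltW r0) ?dist// sup.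
  have p3 : (`|proj_last x| + r) `^ c <= 4 `^ `|c| * `|proj_last z| `^ c.
    by apply: powR_comparable; rewrite ?ler1n ?addr_ge0 ?(ltW r0) ?dist// h.
  rewrite /V /K /power_weight.
  rewrite [leRHS](_ : _ = (4 `^ `|a| * `|proj_init z| `^ a) * (4 `^ `|b| * `|z| `^ b) *
    (4 `^ `|c| * `|proj_last z| `^ c)); last by ring.
  by rewrite !ler_pM ?mulr_ge0 ?powR_ge0.
have K'0 : (0 <= (4 ^+ n.+1)%:E :> \bar R)%E by rewrite lee_fin exprn_ge0.
rewrite (EFinM (4 ^+ n.+1) K) -muleA -ge0_integralZl_EFin ?(ltW K0)//; first last.
- by apply: measurable_power_weight; exact: measurable_rV_ball.
- by move=> z _; rewrite lee_fin power_weight_ge0.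
- exact: measurable_rV_ball.
have mK A : measurable A -> measurable_fun A
    (fun z : 'rV[R]_n.+1 => K%:E * (power_weight a b c z)%:E)%E.
  move=> mA; apply: emeasurable_funM; first exact: measurable_cst.
  exact: measurable_power_weight.
have posK (z : 'rV[R]_n.+1) : (0 <= K%:E * (power_weight a b c z)%:E)%E.
  by rewrite -EFinM lee_fin mulr_ge0 ?power_weight_ge0 ?ltW.
apply: (@le_trans _ _ ((4 ^+ n.+1)%:E *
    \int[lebesgue_rV n.+1]_(z in ball y (r / 4)%R)
      (K%:E * (power_weight a b c z)%:E))%E); last first.
  apply: lee_wpmul2l => //; apply: ge0_subset_integral => //; try exact: measurable_rV_ball.
  by apply: mK; exact: measurable_rV_ball.
apply: (@le_trans _ _ ((4 ^+ n.+1)%:E *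
    \int[lebesgue_rV n.+1]_(z in ball y (r / 4)%R) V%:E)%E); last first.
  apply: lee_wpmul2l => //; apply: ge0_le_integral.
  - exact: measurable_rV_ball.
  - by move=> z _; rewrite lee_fin.
  - exact: measurable_cst.
  - by apply: mK; exact: measurable_rV_ball.
  - by move=> z /Vz; rewrite -EFinM lee_fin.
rewrite [X in (_ * X)%E]integral_cst; last exact: measurable_rV_ball.
apply: (@le_trans _ _ ((4 ^+ n.+1)%:E * (V%:E * ((r / 4) ^+ n.+1)%:E))%E).
  rewrite -!EFinM lee_fin /ball_mass -/V le_eqVlt; apply/orP; left; apply/eqP.
  by rewrite mulrCA -exprMn mulrC (mulrC 4) divfK ?gt_eqF 1?mulrC.
by do 2![apply: lee_wpmul2l; rewrite ?lee_fin//]; exact: lebesgue_rV_ball_ge.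
Qed.

Lemma integral_le_ball_mass n (a b c : R) : (0 < n)%N ->
  (paramA n.+1 `|` paramB n.+1) (a, b, c) -> exists2 C : R, 0 < C &
  forall (x : 'rV[R]_n.+1) (r : R), 0 < r ->
  (\int[lebesgue_rV n.+1]_(y in ball x r) (power_weight a b c y)%:E <=
   (C * ball_mass a b c x r)%:E)%E.
Proof.
move=> n0.
have nE : n.+1%:R - 1 = n%:R :> R by rewrite -natr1 addrK.
case => /= -[]; rewrite nE => an b0 c1.
  (* Here [b] is nonnegative and is not split; the two zeros are placeholders. *)
  apply: (@power_weight_ball_le R n a b c 0 0) => //; last by left.
  by apply: norm_powR_bound_gt; left.
move=> abc; move: abc; rewrite -natr1 => abc.
(* The slacks in the conditions on [a] and [c]. Dividing [b] in proportion to them multiplies both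
   by [(s + u + b) / (s + u)], which is positive exactly because [a + b + c > -(n+1)]. *)
pose s := a + n%:R; pose u := c + 1.
have s0 : 0 < s by rewrite /s; lra.
have u0 : 0 < u by rewrite /u; lra.
have su0 : 0 < s + u by rewrite addr_gt0.
have sub0 : 0 < s + u + b by rewrite /s /u; lra.
pose b1 := b * (s / (s + u)); pose b2 := b * (u / (s + u)).
have b1s : a + b1 + n%:R = s * ((s + u + b) / (s + u)).
  by rewrite /b1 /s; field; rewrite gt_eqF.
have b2s : c + b2 + 1 = u * ((s + u + b) / (s + u)).
  by rewrite /b2 /u; field; rewrite gt_eqF.
have q0 : 0 < (s + u + b) / (s + u) by rewrite divr_gt0.
apply: (@power_weight_ball_le R n a b c b1 b2) => //.
  by apply: norm_powR_bound_gt; left.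
right; split.
- by rewrite mulr_le0_ge0 ?(ltW b0)// divr_ge0// ltW.
- by rewrite mulr_le0_ge0 ?(ltW b0)// divr_ge0// ltW.
- by rewrite /b1 /b2; field; rewrite gt_eqF.
- apply: norm_powR_bound_gt; left.
  have : 0 < a + b1 + n%:R by rewrite b1s mulr_gt0.
  lra.
- split; last by left.
  have : 0 < c + b2 + 1 by rewrite b2s mulr_gt0.
  lra.
Qed.

(** As [k >= 1], [u + k r] lies between [u + r] and [k (u + r)]; the absolute values of the
    exponents account for either sign. *)
Lemma ball_mass_scale n (a b c k : R) (x : 'rV[R]_n.+1) r : 1 <= k -> 0 < r ->
  ball_mass a b c x (k * r) <=
  k `^ `|a| * k `^ `|b| * k `^ `|c| * k ^+ n.+1 * ball_mass a b c x r.
Proof.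
move=> k1 r0; have k0 := lt_le_trans ltr01 k1.
have comp (u e : R) : 0 <= u -> (u + k * r) `^ e <= k `^ `|e| * (u + r) `^ e.
  have kr : r <= k * r by rewrite ler_peMl// ltW.
  have r'0 := ltW r0.
  move=> u0; apply: powR_comparable; rewrite ?addr_ge0 ?mulr_ge0 ?(ltW k0)//.
    by rewrite mulrDr lerD2r ler_peMl.
  by rewrite (le_trans (lerD (lexx u) kr))// ler_peMl// addr_ge0// mulr_ge0// ltW.
rewrite /ball_mass exprMn.
rewrite [leRHS](_ : _ = (k `^ `|a| * (`|proj_init x| + r) `^ a) *
  (k `^ `|b| * (`|x| + r) `^ b) * (k `^ `|c| * (`|proj_last x| + r) `^ c) *
  (k ^+ n.+1 * r ^+ n.+1)); last by ring.
rewrite ler_wpM2r ?mulr_ge0 ?exprn_ge0 ?(ltW k0) ?(ltW r0)//.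
by rewrite !ler_pM ?mulr_ge0 ?powR_ge0 ?comp.
Qed.

Lemma weighted_measure_ball n (a b c : R) : (0 < n)%N ->
  (paramA n.+1 `|` paramB n.+1) (a, b, c) -> exists2 C : R, 0 < C &
  forall (x : 'rV[R]_n.+1) (r : R), 0 < r ->
  (weighted_measure n (a, b, c) (ball x r) <= (C * ball_mass a b c x r)%:E)%E /\
  ((ball_mass a b c x r)%:E <= C%:E * weighted_measure n (a, b, c) (ball x r))%E.
Proof.
move=> n0 htheta.
have [C1 C10 H1] := integral_le_ball_mass n0 htheta.
have [C2 C20 H2] := ball_mass_le_integral a b c n0.
have [L L0 wL] := weight_power_weight n a b c.
have mW A : measurable A -> measurable_fun A (fun y => (weight (a, b, c) y)%:E : \bar R).
  move=> mA; apply/measurable_EFinP; apply: measurable_funTS.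
  exact: measurable_weight.
have int_le (f g : 'rV[R]_n.+1 -> R) (A : set 'rV[R]_n.+1) : measurable A ->
    (forall y, 0 <= f y) -> (forall y, 0 <= g y) ->
    measurable_fun A (EFin \o f) -> measurable_fun A (EFin \o g) ->
    (forall y, f y <= L * g y) ->
  (\int[lebesgue_rV n.+1]_(y in A) (f y)%:E <=
   L%:E * \int[lebesgue_rV n.+1]_(y in A) (g y)%:E)%E.
  move=> mA f0 g0 mf mg fg; rewrite -ge0_integralZl_EFin ?(ltW L0)//; last first.
    by move=> y _; rewrite lee_fin.
  apply: ge0_le_integral => //.
  - by move=> y _; rewrite lee_fin.
  - by apply: emeasurable_funM => //; exact: measurable_cst.
  - by move=> y _; rewrite -EFinM lee_fin.
(* One constant for both bounds: [L * C1] serves the upper and [C2 * L] the lower. *)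
exists (L * C1 + C2 * L); first by rewrite addr_gt0 ?mulr_gt0.
move=> x r r0; have mB := measurable_rV_ball x r.
have mpw := measurable_power_weight a b c mB.
have M0 := ball_mass_ge0 a b c x r0.
split.
  apply: (@le_trans _ _ (L%:E * (C1 * ball_mass a b c x r)%:E)%E).
    apply: le_trans (lee_wpmul2l _ (H1 x r r0)); last by rewrite lee_fin ltW.
    apply: int_le => //; [exact: weight_ge0|exact: power_weight_ge0|exact: mW|].
    by move=> y; have [] := wL y.
  by rewrite -EFinM lee_fin mulrA ler_wpM2r// lerDl mulr_ge0 ?ltW.
apply: (le_trans (H2 x r r0)).
apply: (@le_trans _ _ (C2%:E * (L%:E * weighted_measure n (a, b, c) (ball x r)))%E).
  apply: lee_wpmul2l; first by rewrite lee_fin ltW.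
  apply: int_le => //; [exact: power_weight_ge0|exact: weight_ge0|exact: mW|].
  by move=> y; have [] := wL y.
by rewrite muleA -EFinM lee_wpmul2r// ?lee_fin ?lerDr ?mulr_ge0 ?ltW//.
Qed.

Lemma measurable_eball n (x : 'rV[R]_n) r : measurable (eball x r).
Proof.
rewrite (_ : eball x r = (fun y => enorm (y - x)) @^-1` [set` `]-oo, r[]); last first.
  by apply/seteqP; split => y; rewrite /eball /= in_itv.
rewrite -[X in measurable X]setTI.
have : measurable_fun setT (fun y : 'rV[R]_n => enorm (y - x)).
  apply: (measurableT_comp (@measurable_enorm R n)).
  apply: measurable_fun_rV => i; under eq_fun do rewrite !mxE.
  by apply: measurable_funB => //; exact: measurable_coord.
by apply => //; exact: measurable_itv.
Qed.

Lemma doubling_weighted_measure n (theta : R * R * R) : (0 < n)%N ->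
  (paramA n.+1 `|` paramB n.+1) theta -> doubling (weighted_measure n theta).
Proof.
case: theta => -[a b] c n0 htheta.
have [C C0 HC] := weighted_measure_ball n0 htheta.
(* The Euclidean ball of radius [2 r] lies in the cube of half-side [2 r], and the one of radius [r]
   contains the cube of half-side [r / n.+2]; [k] is the ratio of these half-sides. *)
pose k : R := 2 * n.+2%:R.
have k1 : 1 <= k by rewrite /k -natrM ler1n.
have k0 := lt_le_trans ltr01 k1.
pose K := k `^ `|a| * k `^ `|b| * k `^ `|c| * k ^+ n.+1.
have K0 : 0 < K by rewrite !mulr_gt0 ?powR_gt0 ?exprn_gt0.
exists (C * K * C); split=> [|x r r0]; first by apply: mulr_gt0 => //; exact: mulr_gt0.
pose s := r / n.+2%:R.
have s0 : 0 < s by rewrite divr_gt0.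
have ks : k * s = 2 * r by rewrite /k /s -mulrA (mulrC r) mulVKf.
have r20 : 0 < 2 * r by rewrite mulr_gt0.
apply: (@le_trans _ _ (weighted_measure n (a, b, c) (ball x (2 * r)))).
  apply: le_measure; rewrite ?inE; [exact: measurable_eball|exact: measurable_rV_ball|].
  move=> y; rewrite /eball rV_ballE/= distrC; exact/le_lt_trans/rV_norm_le_enorm.
apply: (le_trans (HC x _ r20).1); rewrite -ks.
apply: (@le_trans _ _ (C * K * ball_mass a b c x s)%:E).
  by rewrite lee_fin -mulrA ler_wpM2l ?(ltW C0)// ball_mass_scale.
rewrite EFinM.
have CK0 : (0 <= (C * K)%:E)%E by rewrite lee_fin ltW// mulr_gt0.
apply: (le_trans (lee_wpmul2l CK0 (HC x s s0).2)).
rewrite muleA -EFinM; apply: lee_wpmul2l.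
  by rewrite lee_fin ltW// mulr_gt0// mulr_gt0.
apply: le_measure; rewrite ?inE; [exact: measurable_rV_ball|exact: measurable_eball|].
move=> y; rewrite /eball rV_ballE/= distrC => xy.
apply: (le_lt_trans (enorm_le_rV_norm _)).
by rewrite mulrC -ltr_pdivlMr.
Qed.

End doubling.

(** * Regularity of locally finite Borel measures *)

Section radon.
Context {R : realType} (n : nat).

Lemma compact_rV_ball_cover (K : set 'rV[R]_n) : compact K ->
  exists2 r : R, 0 < r & K `<=` ball 0 r.
Proof.
move=> /compact_bounded [M [Mr KM]].
exists (`|M| + 2); first by rewrite ltr_wpDl.
move=> x Kx; rewrite rV_ballE/= sub0r normrN.
have /KM /(_ x Kx) /= : M < `|M| + 1 by have := ler_norm M; lra.
lra.
Qed.

Lemma compact_rV_norm_le (M : R) : compact [set x : 'rV[R]_n | `|x| <= M].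
Proof.
apply: bounded_closed_compact.
  exists M; split; first exact: num_real.
  by move=> M' MM' x /= xM; rewrite (le_trans xM)// ltW.
rewrite [X in closed X](_ : _ = (fun x : 'rV[R]_n => `|x|) @^-1` [set t | t <= M])//.
by apply: preimage_closed => [x _|]; [exact: norm_continuous|exact: closed_le].
Qed.

Lemma measurable_rV_compact (K : set 'rV[R]_n) : compact K -> measurable K.
Proof.
move=> cK; rewrite -(setCK K); apply: measurableC; apply: open_measurable_rV.
by apply: closed_openC; apply: compact_closed => //; exact: norm_hausdorff.
Qed.

(** The compact sets consist of the points of norm at most [k] that lie in no ball of radius
    [1 / k.+1] centred outside [U]. *)
Lemma open_rV_sigma_compact (U : set 'rV[R]_n) : open U ->
  exists K : nat -> set 'rV[R]_n, [/\ forall k, compact (K k),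
    nondecreasing_seq K & \bigcup_k K k = U].
Proof.
move=> oU.
pose far k : set 'rV[R]_n := ~` \bigcup_(y in ~` U) ball y k.+1%:R^-1.
exists (fun k => far k `&` [set x | `|x| <= k%:R]); split.
- move=> k; rewrite setIC; apply: compact_closedI.
    exact: compact_rV_norm_le.
  by apply: open_closedC; apply: bigcup_open => y _; exact: ball_open.
- move=> i j ij; apply/subsetPset => x [fx /= xi]; split => /=.
    move=> [y nUy yx]; apply: fx; exists y => //; apply: le_ball yx.
    by rewrite lef_pV2 ?posrE// ler_nat.
  by rewrite (le_trans xi)// ler_nat.
- apply/seteqP; split => [x [k _ [fx _]]|x Ux].
    by apply: contrapT => nUx; apply: fx; exists x => //; exact: ballxx.
  have [e /= e0 eU] := (nbhs_ballP _ _).1 (open_nbhs_nbhs (conj oU Ux)).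
  (* Makes both [1 / k.+1 < e] and [|x| <= k] hold; the radius already involves [k.+1], so only the
     second truncation needs a successor. *)
  pose k := maxn (Num.truncn e^-1) (Num.truncn `|x|).+1.
  exists k => //; split => /=; last first.
    by rewrite (le_trans (ltW (truncnS_gt _)))// ler_nat leq_maxr.
  move=> [y nUy yx]; apply: nUy; apply: eU; apply: ball_sym.
  apply: le_ball yx; rewrite ltW// invf_plt ?posrE//.
  by rewrite (lt_le_trans (truncnS_gt _))// ler_nat ltnS leq_maxl.
Qed.

Variable mu : {measure set 'rV[R]_n -> \bar R}.

(* With F = ~` V this reads F `<=` A `<=` U, F closed, U open, U `\` F small in B;
   in this form it is visibly invariant under complement. *)
Let approx (B A : set 'rV[R]_n) := forall e : R, 0 < e ->
  exists U V : set 'rV[R]_n, [/\ open U, open V, A `<=` U, ~` A `<=` V &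
    (mu (U `&` V `&` B) <= e%:E)%E].

Let mopen3 (U V B : set 'rV[R]_n) : measurable B -> open U -> open V ->
  measurable (U `&` V `&` B).
Proof.
move=> mB oU oV; apply: measurableI => //.
by apply: measurableI; exact: open_measurable_rV.
Qed.

(** Continuity from above, available because [B] has finite mass: were every term larger than [e],
    so would be the limit, up to equality. *)
Let small_inter (e : R) (B : set 'rV[R]_n) (D : nat -> set 'rV[R]_n) :
  0 < e -> measurable B -> (mu B < +oo)%E ->
  (forall k, measurable (D k)) -> nonincreasing_seq D ->
  (mu (\bigcap_k (D k `&` B)) < e%:E)%E ->
  exists k, (mu (D k `&` B) <= e%:E)%E.
Proof.
move=> e0 mB fB mD nD small; apply: contrapT => /forallNP big.
have mDB k : measurable (D k `&` B) by exact: measurableI.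
have cv : (mu (D k `&` B) @[k --> \oo] --> mu (\bigcap_k (D k `&` B)))%E.
  apply: (@nonincreasing_cvg_mu _ _ _ mu (fun k => D k `&` B)) => //.
  - by apply: le_lt_trans fB; apply: le_measure; rewrite ?inE//; exact: subIsetr.
  - exact: bigcapT_measurable.
  - move=> i j ij; apply/subsetPset => x [Dx Bx]; split => //.
    by move: x Dx {Bx}; apply/subsetPset; exact: nD.
have : (e%:E <= mu (\bigcap_k (D k `&` B)))%E.
  by apply: (cvge_to_ge cv); apply: nearW => k; apply/ltW; rewrite ltNge; apply/negP.
by rewrite leNgt small.
Qed.

(** With [V] the complement of a compact set [K k] exhausting [U], the sets [U] minus [K k] decrease
    to the empty set. *)
Let approx_open (B U : set 'rV[R]_n) : measurable B -> (mu B < +oo)%E ->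
  open U -> approx B U.
Proof.
move=> mB fB oU e e0; have [K [cK ndK KU]] := open_rV_sigma_compact oU.
have oK k : open (~` K k).
  by apply: closed_openC; apply: compact_closed => //; exact: norm_hausdorff.
have [k muk] : exists k, (mu (U `&` ~` K k `&` B) <= e%:E)%E.
  apply: small_inter => //.
  - by move=> k; apply: measurableI; exact: open_measurable_rV.
  - move=> i j ij; apply/subsetPset; apply: setIS; apply: subsetC.
    by apply/subsetPset; exact: ndK.
  - rewrite (_ : \bigcap_k _ = set0) ?measure0// -subset0 => x h.
    have [[Ux _] _] := h 0%N I.
    by move: Ux; rewrite -KU => -[k _ Kx]; have [[_ +] _] := h k I.
exists U, (~` K k); split=> //; apply: subsetC.
by rewrite -KU; exact: bigcup_sup.
Qed.

Let open_bigcap_ord (V : nat -> set 'rV[R]_n) k :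
  (forall i, open (V i)) -> open (\bigcap_(i in `I_k) V i).
Proof.
move=> oV; elim: k => [|k IH].
  by rewrite II0 bigcap_set0; exact: openT.
by rewrite IIS bigcap_setU bigcap_set1; exact: openI.
Qed.

(** Complementation exchanges [U] and [V]. For a countable union, the intersection of all the [V_i]
    may fail to be open; finitely many are intersected instead, their number coming from
    [small_inter]. *)
Let approx_sigma_algebra (B : set 'rV[R]_n) : measurable B -> (mu B < +oo)%E ->
  sigma_algebra setT (approx B).
Proof.
move=> mB fB; split.
- by apply: approx_open => //; exact: open0.
- move=> A hA e e0; have [U [V [oU oV AU AV UV]]] := hA e e0.
  by exists V, U; rewrite setTD setCK (setIC V); split.
- move=> A hA e e0.
  (* Half of [e] is kept back because [small_inter] asks for a strict inequality in the limit. *)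
  have e20 : 0 < e / 2 by rewrite divr_gt0.
  have /choice[UV hUV] : forall i, exists UV : set 'rV[R]_n * set 'rV[R]_n,
      [/\ open UV.1, open UV.2, A i `<=` UV.1, ~` A i `<=` UV.2 &
       (mu (UV.1 `&` UV.2 `&` B) <= (e / 2 / (2 ^ i.+1)%:R)%:E)%E].
    move=> i; have /(hA i)[U [V h]] : 0 < e / 2 / (2 ^ i.+1)%:R.
      by rewrite divr_gt0// ltr0n expn_gt0.
    by exists (U, V).
  pose U := \bigcup_i (UV i).1.
  pose V k := \bigcap_(i in `I_k) (UV i).2.
  have oU : open U by apply: bigcup_open => i _; have [] := hUV i.
  have oV k : open (V k) by apply: open_bigcap_ord => i; have [] := hUV i.
  have [k muk] : exists k, (mu (U `&` V k `&` B) <= e%:E)%E.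
    apply: small_inter => //.
    + by move=> k; apply: measurableI; exact: open_measurable_rV.
    + move=> i j ij; apply/subsetPset; apply: setIS.
      by move=> x h m /= mi; apply: h; exact: leq_trans mi ij.
    + apply: (@le_lt_trans _ _ (e / 2)%:E); last by rewrite lte_fin; lra.
      apply: le_trans (epsilon_trick0 xpredT (ltW e20)).
      apply: (@le_trans _ _ (\sum_(i <oo) mu ((UV i).1 `&` (UV i).2 `&` B))%E).
        apply: measure_sigma_subadditive.
        * by move=> i; have [? ? _ _ _] := hUV i; exact: mopen3.
        * by apply: bigcapT_measurable => k; exact: mopen3.
        * move=> x h; have [[[i _ Ux] _] Bx] := h 0%N I.
          exists i => //; split=> //; split=> //.
          (* [V i.+1] is the first partial intersection that includes the index [i]. *)
          by have [[_ Vx] _] := h i.+1 I; apply: Vx => /=.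
      by apply: lee_nneseries => // i _; have [] := hUV i.
  exists U, (V k); split => //.
  + by apply: subset_bigcup => i _; have [] := hUV i.
  + move=> x nA i _; have [_ _ _ + _] := hUV i; apply => Ax.
    by apply: nA; exists i.
Qed.

(** The mass of [A] may be infinite, so [A] is approximated inside each of the cubes [B k], with
    errors summing to at most [e], and the pieces are glued. A point of the glued set outside [A]
    lies in some [U_i], [V_i] and [B i] at once. *)
Let outer_regular (A : set 'rV[R]_n) (e : R) :
  (forall K, compact K -> (mu K < +oo)%E) -> measurable A -> 0 < e ->
  exists2 U, open U /\ A `<=` U & (mu U <= mu A + e%:E)%E.
Proof.
move=> finK mA e0.
pose B k : set 'rV[R]_n := ball 0 k.+1%:R.
have mB k : measurable (B k) by exact: measurable_rV_ball.
have fB k : (mu (B k) < +oo)%E.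
  have := finK _ (@compact_rV_norm_le k.+1%:R); apply: le_lt_trans; apply: le_measure; rewrite ?inE//.
    by apply: measurable_rV_compact; exact: compact_rV_norm_le.
  by rewrite /B rV_ballE => x /=; rewrite sub0r normrN => /ltW.
(* The approximable sets form a sigma-algebra containing the open sets, hence all Borel sets. *)
have hA k : approx (B k) A.
  move: mA; apply: smallest_sub; first exact: approx_sigma_algebra.
  by move=> U oU; exact: approx_open.
have /choice[UV hUV] : forall i, exists UV : set 'rV[R]_n * set 'rV[R]_n,
    [/\ open UV.1, open UV.2, A `<=` UV.1, ~` A `<=` UV.2 &
     (mu (UV.1 `&` UV.2 `&` B i) <= (e / (2 ^ i.+1)%:R)%:E)%E].
  move=> i; have /(hA i)[U [V h]] : 0 < e / (2 ^ i.+1)%:R.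
    by rewrite divr_gt0// ltr0n expn_gt0.
  by exists (U, V).
have oB k : open (B k) by exact: ball_open.
pose U := \bigcup_i ((UV i).1 `&` B i).
have oU : open U.
  by apply: bigcup_open => i _; have [? _ _ _ _] := hUV i; exact: openI.
have AU : A `<=` U.
  move=> x Ax; exists (Num.truncn `|x|) => //; split.
    by have [_ _ + _ _] := hUV (Num.truncn `|x|); apply.
  by rewrite /B rV_ballE/= sub0r normrN truncnS_gt.
exists U => //.
have mU := open_measurable_rV oU.
rewrite (_ : U = A `|` (U `\` A)); last by rewrite setDUK.
apply: (le_trans (measureU2 _ _ _)) => //; first exact: measurableD.
apply: leeD => //; apply: le_trans (epsilon_trick0 xpredT (ltW e0)).
apply: (@le_trans _ _ (\sum_(i <oo) mu ((UV i).1 `&` (UV i).2 `&` B i))%E).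
  apply: measure_sigma_subadditive.
  - by move=> i; have [? ? _ _ _] := hUV i; exact: mopen3.
  - exact: measurableD.
  - move=> x [[i _ [Ux Bx]] nAx]; exists i => //; split=> //; split=> //.
    by have [_ _ _ + _] := hUV i; apply.
by apply: lee_nneseries => // i _; have [] := hUV i.
Qed.

(** Outer regularity is [outer_regular] with [e] tending to 0; inner regularity is continuity from
    below along a compact exhaustion of [U]. *)
Lemma radon_rV : (forall K, compact K -> (mu K < +oo)%E) -> radon mu.
Proof.
move=> finK; split=> // [A mA|U oU].
  apply/eqP; rewrite eq_le; apply/andP; split.
    apply: le_ereal_inf_tmp => _ [U [oU AU] <-].
    by apply: le_measure; rewrite ?inE//; exact: open_measurable_rV.
  apply/lee_addgt0Pr => e e0; have [U [oU AU] UA] := outer_regular finK mA e0.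
  by apply: le_trans UA; apply: ereal_inf_lbound; exists U.
apply/eqP; rewrite eq_le; apply/andP; split; last first.
  apply: ge_ereal_sup => _ [K [cK KU] <-]; apply: le_measure; rewrite ?inE//.
    exact: measurable_rV_compact.
  exact: open_measurable_rV.
have [K [cK ndK KU]] := open_rV_sigma_compact oU.
have cv : (mu (K k) @[k --> \oo] --> mu U)%E.
  rewrite -KU; apply: (@nondecreasing_cvg_mu _ _ _ mu K) => //.
    by move=> k; exact: measurable_rV_compact.
  by rewrite KU; exact: open_measurable_rV.
apply: (cvge_to_le cv); apply: nearW => k; apply: ereal_sup_ubound.
exists (K k) => //; split=> //; rewrite -KU; exact: bigcup_sup.
Qed.

End radon.

Theorem theorem2p7 (R : realType) (n : nat) (hn : (2 <= n.+1)%N)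
    (theta : R * R * R) (htheta : (paramA n.+1 `|` paramB n.+1) theta) :
  radon (weighted_measure n theta) /\ doubling (weighted_measure n theta).
Proof.
have n0 : (0 < n)%N by [].
split; last exact: doubling_weighted_measure.
(* Finiteness on compact sets: each lies in a cube about the origin, whose mass is bounded by a real
   multiple of M. *)
apply: radon_rV => K cK; have [r r0 Kr] := compact_rV_ball_cover cK.
case: theta htheta => -[a b] c htheta.
have [C C0 HC] := weighted_measure_ball n0 htheta.
apply: le_lt_trans (le_lt_trans (HC 0 r r0).1 (ltry _)).
apply: le_measure; rewrite ?inE//; first exact: measurable_rV_compact.
exact: measurable_rV_ball.
Qed.
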